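(* (GBC) For any class forcing notion $\mathbb P$, the following are equivalent: (i) $\mathbb P$ admits a forcing relation for atomic formulas; (ii) $\mathbb P$ admits a uniform forcing relation for quantifier-free infinitary formulas in the forcing language $\mathcal L_{\mathrm{Ord},0}(\in,\dot G)$; (iii) $\mathbb P$ admits a Boolean completion, a set-complete class Boolean algebra $\mathbb B$ into which $\mathbb P$ densely embeds.
   Context: A class forcing notion is a separative class pre-order $\mathbb P$ with top $\mathbb 1$; $\dot G=\{\langle\check p,p\rangle:p\in\mathbb P\}$. A forcing relation for atomic formulas: relations $p\Vdash\sigma\in\tau$, $p\Vdash\sigma\subseteq\tau$, $p\Vdash\sigma=\tau$ with (a) $p\Vdash\sigma\in\tau$ iff densely many $q\le p$ have $\langle\rho,r\rangle\in\tau$ with $q\le r$, $q\Vdash\sigma=\rho$; (b) $p\Vdash\sigma=\tau$ iff $p\Vdash\sigma\subseteq\tau$ and $p\Vdash\tau\subseteq\sigma$; (c) $p\Vdash\sigma\subseteq\tau$ iff whenever $\langle\rho,r\rangle\in\sigma$ and $q'\le p,r$ there is $q\le q'$ with $q\Vdash\rho\in\tau$. $\mathcal L_{\mathrm{Ord},0}(\in,\dot G)$: sentences with $\mathbb P$-names as constants built from atomic $\sigma=\tau$, $\sigma\in\tau$, $\sigma\in\dot G$ by negation and set-sized conjunctions. A uniform forcing relation for it: a relation on all its sentences satisfying (a)–(c), $p\Vdash\sigma\in\dot G$ iff densely many $q\le p$ have $\langle\tau,r\rangle\in\dot G$ with $q\le r$, $q\Vdash\sigma=\tau$, $p\Vdash\bigwedge_j\varphi_j$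 iff $p\Vdash\varphi_j$ for all $j$, and $p\Vdash\neg\varphi$ iff no $q\le p$ forces $\varphi$. A set-complete class Boolean algebra is a class Boolean algebra in which every subset has a supremum and infimum; $\mathbb P$ densely embeds into $\mathbb B$ if there is a map $i:\mathbb P\to\mathbb B\setminus\{0\}$ preserving order and incompatibility whose image is dense in $\mathbb B\setminus\{0\}$. *)

(* Defs.v *)
Set Implicit Arguments.
Unset Strict Implicit.

(* A theorem of GBC is rendered as a statement about every model of GBC, a
   two-sorted structure with sets and classes.  Everything below (names, coded
   formulas, forcing relations, Boolean algebras) lives inside the model: only
   sets and classes of the model are quantified over, and the model is not
   assumed to be well-founded in the ambient type theory. *)

Record gb_structure := GBStructure {
  V : Type;
  Class : Type;
  mem : V -> V -> Prop;
  cmem : Class -> V -> Prop }.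

Coercion cmem : Class >-> Funclass.

Notation "x ∈ y" := (mem x y) (at level 70, no associativity).

Section Structure.
Context {M : gb_structure}.
Notation V := (V M).
Notation Class := (Class M).
Implicit Types (x y z : V) (X F R : Class).

(* Formulas with set quantifiers only, in de Bruijn style; [FCls k i] says
   that the i-th set variable belongs to the k-th class parameter. *)
Inductive formula : Type :=
| FMem (i j : nat)
| FEq (i j : nat)
| FCls (k i : nat)
| FNeg (f : formula)
| FAnd (f g : formula)
| FAll (f : formula).

Definition scons x (e : nat -> V) : nat -> V :=
  fun n => match n with 0 => x | S m => e m end.

Fixpoint sat (C : nat -> Class) (e : nat -> V) (f : formula) : Prop :=
  match f with
  | FMem i j => e i ∈ e j
  | FEq i j => e i = e j
  | FCls k i => C k (e i)
  | FNeg g => ~ sat C e g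
  | FAnd g h => sat C e g /\ sat C e h
  | FAll g => forall x, sat C (scons x e) g
  end.

Definition is_upair z x y : Prop := forall w, w ∈ z <-> w = x \/ w = y.

(* Kuratowski pairs *)
Definition is_opair z x y : Prop :=
  exists s d, is_upair s x x /\ is_upair d x y /\ is_upair z s d.

Definition rel R x y : Prop := exists z, is_opair z x y /\ R z.

Definition rel3 R x y z : Prop := exists w, is_opair w y z /\ rel R x w.

Definition setrel f x y : Prop := exists z, is_opair z x y /\ z ∈ f.

Definition is_empty z : Prop := forall w, ~ w ∈ z.

Definition is_succ z y : Prop := forall w, w ∈ z <-> w ∈ y \/ w = y.

Fixpoint is_num (n : nat) z : Prop :=
  match n with
  | 0 => is_empty z
  | S m => exists y, is_num m y /\ is_succ z y
  end.

End Structure.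

Record GBC (M : gb_structure) : Prop := {
  gbc_set_ext : forall x y : V M, (forall z, z ∈ x <-> z ∈ y) -> x = y;
  gbc_class_ext : forall X Y : Class M, (forall z, X z <-> Y z) -> X = Y;
  gbc_foundation : forall x y : V M, y ∈ x ->
    exists z, z ∈ x /\ forall w, w ∈ z -> ~ w ∈ x;
  gbc_pairing : forall x y : V M, exists z, is_upair z x y;
  gbc_union : forall x : V M, exists u, forall z, z ∈ u <-> exists y, y ∈ x /\ z ∈ y;
  gbc_power : forall x : V M,
    exists u, forall z, z ∈ u <-> forall w, w ∈ z -> w ∈ x;
  gbc_infinity : exists u : V M,
    (exists z, is_empty z /\ z ∈ u) /\
    (forall y, y ∈ u -> exists z, is_succ z y /\ z ∈ u);
  gbc_replacement : forall (F : Class M) (a : V M),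
    (forall x y y', rel F x y -> rel F x y' -> y = y') ->
    exists b, forall y, y ∈ b <-> exists x, x ∈ a /\ rel F x y;
  gbc_comprehension : forall (f : formula) (C : nat -> Class M) (e : nat -> V M),
    exists X : Class M, forall x, X x <-> sat C (scons x e) f;
  gbc_global_choice : exists F : Class M,
    (forall x y y', rel F x y -> rel F x y' -> y = y') /\
    (forall x, ~ is_empty x -> exists y, y ∈ x /\ rel F x y) }.

Section Forcing.
Context {M : gb_structure}.
Notation V := (V M).
Notation Class := (Class M).

Definition compatible (D : V -> Prop) (le : V -> V -> Prop) (p q : V) : Prop :=
  exists r, D r /\ le r p /\ le r q.

Record class_forcing (P le : Class) (one : V) : Prop := {
  cf_refl : forall p, P p -> rel le p p;
  cf_trans : forall p q r, P p -> P q -> P r ->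
    rel le p q -> rel le q r -> rel le p r;
  cf_separative : forall p q, P p -> P q -> ~ rel le p q ->
    exists r, P r /\ rel le r p /\ ~ compatible P (rel le) r q;
  cf_top_in : P one;
  cf_top : forall p, P p -> rel le p one }.

Section Names.
Variables (P le : Class) (one : V).

(* "Every element of s is a pair <t,p> with t a name and p in P", a recursion
   on membership carried out inside the model: it is witnessed by a set T of
   names that contains s and is closed under passing to such t. *)
Definition is_name (s : V) : Prop :=
  exists T, s ∈ T /\
    forall x y, x ∈ T -> y ∈ x -> exists t p, is_opair y t p /\ t ∈ T /\ P p.

(* c is the check name of x, by recursion inside the model: f is a set function
   with transitive domain and f(a) = { <f(w),1> : w in a }. *)
Definition is_check (x c : V) : Prop :=
  exists f, setrel f x c /\
    (forall a b b', setrel f a b -> setrel f a b' -> b = b') /\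
    (forall a b, setrel f a b ->
       (forall w, w ∈ a -> exists v, setrel f w v) /\
       (forall z, z ∈ b <-> exists w v, w ∈ a /\ setrel f w v /\ is_opair z v one)).

(* <t,r> belongs to the canonical name for the generic filter *)
Definition in_Gdot (t r : V) : Prop := P r /\ is_check r t.

Definition densely_below (p : V) (Q : V -> Prop) : Prop :=
  forall p', P p' -> rel le p' p -> exists q, P q /\ rel le q p' /\ Q q.

Record is_atomic_forcing (Fin Fsub Feq : V -> V -> V -> Prop) : Prop := {
  af_in : forall p s t, P p -> is_name s -> is_name t ->
    (Fin p s t <-> densely_below p (fun q =>
       exists u r, setrel t u r /\ rel le q r /\ Feq q s u));
  af_eq : forall p s t, P p -> is_name s -> is_name t ->
    (Feq p s t <-> Fsub p s t /\ Fsub p t s);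
  af_sub : forall p s t, P p -> is_name s -> is_name t ->
    (Fsub p s t <-> forall u r q', setrel s u r ->
       P q' -> rel le q' p -> rel le q' r ->
       exists q, P q /\ rel le q q' /\ Fin q u t) }.

Definition admits_atomic_forcing_relation : Prop :=
  exists Fin Fsub Feq : Class,
    is_atomic_forcing (rel3 Fin) (rel3 Fsub) (rel3 Feq).

(* The infinitary language is coded by sets of the model: a formula is a pair
   <n,x> with the numeral n recording the outermost constructor. *)
Definition tagged (n : nat) (c x : V) : Prop :=
  exists k, is_num n k /\ is_opair c k x.

Definition eq_code (c s t : V) : Prop := exists x, is_opair x s t /\ tagged 0 c x.
Definition in_code (c s t : V) : Prop := exists x, is_opair x s t /\ tagged 1 c x.
Definition gen_code (c s : V) : Prop := tagged 2 c s.
Definition neg_code (c d : V) : Prop := tagged 3 c d.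
(* conjunction of the set J of formulas *)
Definition conj_code (c J : V) : Prop := tagged 4 c J.

(* Again a recursion inside the model: T is a set of formulas that contains c
   and is closed under immediate subformulas. *)
Definition is_sentence (c : V) : Prop :=
  exists T, c ∈ T /\ forall d, d ∈ T ->
    (exists s t, is_name s /\ is_name t /\ eq_code d s t) \/
    (exists s t, is_name s /\ is_name t /\ in_code d s t) \/
    (exists s, is_name s /\ gen_code d s) \/
    (exists d', d' ∈ T /\ neg_code d d') \/
    (exists J, (forall d', d' ∈ J -> d' ∈ T) /\ conj_code d J).

(* Inclusion is not an atomic formula of the language, so the relation
   "p forces s included in t" is a separate component Fsub. *)
Record is_uniform_forcing (F Fsub : Class) : Prop := {
  uf_atomic : is_atomic_forcing
    (fun p s t => exists c, in_code c s t /\ rel F p c)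
    (rel3 Fsub)
    (fun p s t => exists c, eq_code c s t /\ rel F p c);
  uf_gen : forall p s c, P p -> is_name s -> gen_code c s ->
    (rel F p c <-> densely_below p (fun q =>
       exists t r, in_Gdot t r /\ rel le q r /\
         exists d, eq_code d s t /\ rel F q d));
  uf_conj : forall p c J, P p -> is_sentence c -> conj_code c J ->
    (rel F p c <-> forall d, d ∈ J -> rel F p d);
  uf_neg : forall p c d, P p -> is_sentence c -> neg_code c d ->
    (rel F p c <-> forall q, P q -> rel le q p -> ~ rel F q d) }.

Definition admits_uniform_forcing_relation : Prop :=
  exists F Fsub : Class, is_uniform_forcing F Fsub.

End Names.

Section Boolean.
Variables (B le : Class).

Definition is_sup (A : V -> Prop) (s : V) : Prop :=
  B s /\ (forall a, A a -> rel le a s) /\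
  (forall b, B b -> (forall a, A a -> rel le a b) -> rel le s b).

Definition is_inf (A : V -> Prop) (s : V) : Prop :=
  B s /\ (forall a, A a -> rel le s a) /\
  (forall b, B b -> (forall a, A a -> rel le b a) -> rel le b s).

Definition is_join (a b s : V) : Prop := is_sup (fun x => x = a \/ x = b) s.
Definition is_meet (a b s : V) : Prop := is_inf (fun x => x = a \/ x = b) s.

(* complemented distributive lattices *)
Record class_boolean_algebra (zero unit : V) : Prop := {
  cba_refl : forall a, B a -> rel le a a;
  cba_antisym : forall a b, B a -> B b -> rel le a b -> rel le b a -> a = b;
  cba_trans : forall a b c, B a -> B b -> B c ->
    rel le a b -> rel le b c -> rel le a c;
  cba_join : forall a b, B a -> B b -> exists s, is_join a b s;
  cba_meet : forall a b, B a -> B b -> exists s, is_meet a b s;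
  cba_zero_in : B zero;
  cba_zero : forall a, B a -> rel le zero a;
  cba_unit_in : B unit;
  cba_unit : forall a, B a -> rel le a unit;
  cba_distr : forall a b c bc ab ac l r, B a -> B b -> B c ->
    is_join b c bc -> is_meet a bc l ->
    is_meet a b ab -> is_meet a c ac -> is_join ab ac r -> l = r;
  cba_compl : forall a, B a ->
    exists a', B a' /\ is_meet a a' zero /\ is_join a a' unit }.

Definition set_complete : Prop :=
  forall A : V, (forall a, a ∈ A -> B a) ->
    (exists s, is_sup (fun a => a ∈ A) s) /\ (exists s, is_inf (fun a => a ∈ A) s).

End Boolean.

Definition densely_embeds (P leP B leB : Class) (zero : V) : Prop :=
  let Bpos := fun b => B b /\ b <> zero in
  exists i : Class,
    (forall p, P p -> exists b, Bpos b /\ forall b', rel i p b' <-> b' = b) /\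
    (forall p q a b, P p -> P q -> rel i p a -> rel i q b ->
       rel leP p q -> rel leB a b) /\
    (forall p q a b, P p -> P q -> rel i p a -> rel i q b ->
       ~ compatible P (rel leP) p q -> ~ compatible Bpos (rel leB) a b) /\
    (forall b, Bpos b -> exists p a, P p /\ rel i p a /\ rel leB a b).

Definition admits_boolean_completion (P leP : Class) : Prop :=
  exists (B leB : Class) (zero unit : V),
    class_boolean_algebra B leB zero unit /\
    set_complete B leB /\
    densely_embeds P leP B leB zero.

End Forcing.

(* Main.v *)
Require Import Defs.
From Stdlib Require Import Classical ClassicalEpsilon FunctionalExtensionality
  PropExtensionality Arith.

(** The theorem is proved through an intermediate notion, a class [B] of truth
    values: each [b : B] has a regular open class [T b] of conditions below it, and
    these are closed under complements and set-sized intersections and include the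
    cones [{q | q <= p}].

    From an atomic forcing relation: a truth value is a pair of equations between
    names such that the second one is forced exactly where the first one is forced to
    fail, and the complement swaps the two equations.  Set-sized conjunctions and
    disjunctions of equations are again equations.  With [U = {{a_k} | k}] and
    [w_k = {a_k, b_k}], all [a_k = b_k] hold iff [{w_k | k} ⊆ U], and some
    [a_k = b_k] holds iff [U] is one of the sets [U ∪ {w_k}].  Scott's trick replaces
    equivalence classes by sets, so that a truth value is determined by [T b].

    Truth values form a Boolean completion, and conversely a completion gives truth
    values, with [T b] the conditions whose image is below [b].

    Given truth values, the values of [s = t] and then of all infinitary sentences are
    obtained by recursion on rank, and the value of an infinitary sentence yields the
    uniform forcing relation.  The generic filter needs only a set of check names,
    because the [r] such that some condition forces [s = check r] form a set. *)

(** The obstacle is that comprehension admits set quantifiers only. Truth values replace these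
    classes by sets: the recursions then have set values, their approximations are sets, and
    quantifying over approximations stays within comprehension. Distinct truth values are made to
    have distinct classes [T b], because replacement and the selection of the value of a formula
    both ask for a unique witness. Since the model need not be well-founded from outside, every
    induction and recursion runs inside it, and each predicate involved has to be shown definable.

    By De Morgan's laws the complement of a conjunction is a disjunction of complements, so closure
    under infima already requires that disjunctions of equations be equations. *)

Section GBCModel.
Context {M : gb_structure}.
Hypothesis HM : GBC M.
Local Notation V := (V M).
Local Notation Class := (Class M).
Local Notation "x ∈ y" := (@mem M x y) (at level 70, no associativity).

(** * Definability by formulas with class parameters *)

Fixpoint ren (rc rv : nat -> nat) (f : formula) : formula :=
  match f with
  | FMem i j => FMem (rv i) (rv j)
  | FEq i j => FEq (rv i) (rv j)
  | FCls k i => FCls (rc k) (rv i)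
  | FNeg g => FNeg (ren rc rv g)
  | FAnd g h => FAnd (ren rc rv g) (ren rc rv h)
  | FAll g => FAll (ren rc (fun n => match n with 0 => 0 | S m => S (rv m) end) g)
  end.

Lemma sat_ren f : forall rc rv (C C' : nat -> Class) (e e' : nat -> V),
  (forall k, C' (rc k) = C k) -> (forall n, e' (rv n) = e n) ->
  (sat C' e' (ren rc rv f) <-> sat C e f).
Proof.
  induction f; intros rc rv C C' e e' HC He; simpl; try rewrite !He; try rewrite HC;
    try reflexivity.
  - rewrite (IHf rc rv C C' e e' HC He); reflexivity.
  - rewrite (IHf1 rc rv C C' e e' HC He), (IHf2 rc rv C C' e e' HC He); reflexivity.
  - split; intros H x; specialize (H x); revert H; apply IHf; trivial;
      intros [|n]; simpl; auto.
Qed.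

(** The class parameters are hidden in the existential, so that definable predicates can be combined
    without agreeing on a parameter list. Set parameters enter as singleton classes, see
    [dt_const]. *)
Definition definable (Q : (nat -> V) -> Prop) : Prop :=
  exists (C : nat -> Class) f, forall e, Q e <-> sat C e f.

(** The formula language has no function symbols, so a function of the environment is handled
    through its graph, with the value in variable 0 and the environment shifted by one. *)
Definition dterm (t : (nat -> V) -> V) : Prop :=
  definable (fun e => e 0 = t (fun n => e (S n))).

Lemma definable_ext Q Q' :
  (forall e, Q e <-> Q' e) -> definable Q' -> definable Q.
Proof.
  intros H (C & f & Hf); exists C, f; intro e; rewrite H; apply Hf.
Qed.

Lemma inhabited_V : inhabited V.
Proof. destruct (gbc_infinity HM) as (u & _); constructor; exact u. Qed.

Lemma class_of (Q : V -> Prop) :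
  definable (fun e => Q (e 0)) -> exists X : Class, forall x, X x <-> Q x.
Proof.
  intros (C & f & Hf). destruct inhabited_V as [v].
  destruct (gbc_comprehension HM f C (fun _ => v)) as (X & HX).
  exists X; intro x; rewrite HX, <- Hf; reflexivity.
Qed.

Lemma def_ren Q r : definable Q -> definable (fun e => Q (fun n => e (r n))).
Proof.
  intros (C & f & Hf); exists C, (ren (fun k => k) r f); intro e.
  rewrite Hf; symmetry; apply sat_ren; reflexivity.
Qed.

Lemma dt_ren t r : dterm t -> dterm (fun e => t (fun n => e (r n))).
Proof.
  intro H.
  exact (def_ren _ (fun n => match n with 0 => 0 | S m => S (r m) end) H).
Qed.

Lemma def_not Q : definable Q -> definable (fun e => ~ Q e).
Proof.
  intros (C & f & Hf); exists C, (FNeg f); intro e; simpl; rewrite Hf; reflexivity.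
Qed.

Lemma def_and Q Q' :
  definable Q -> definable Q' -> definable (fun e => Q e /\ Q' e).
Proof.
  intros (C & f & Hf) (C' & f' & Hf').
  (* The two parameter sequences are interleaved, the first on the even and the second on the odd
     indices. *)
  exists (fun n => if Nat.even n then C (Nat.div2 n) else C' (Nat.div2 n)).
  exists (FAnd (ren (fun k => 2 * k) (fun k => k) f)
               (ren (fun k => S (2 * k)) (fun k => k) f')).
  intro e; cbn [sat]; rewrite Hf, Hf'.
  rewrite (sat_ren f _ _ C _ e), (sat_ren f' _ _ C' _ e); try reflexivity.
  - intro k; rewrite Nat.even_succ, Nat.odd_mul; simpl Nat.odd at 1;
      cbv [andb]; rewrite Nat.div2_succ_double; reflexivity.
  - intro k; rewrite Nat.even_mul; simpl Nat.even at 1; cbv [orb];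
      rewrite Nat.div2_double; reflexivity.
Qed.

Lemma def_all (Q : (nat -> V) -> V -> Prop) :
  definable (fun e => Q (fun n => e (S n)) (e 0)) ->
  definable (fun e => forall x, Q e x).
Proof.
  intros (C & f & Hf); exists C, (FAll f); intro e; simpl.
  split; intros H x; specialize (H x).
  - apply Hf; exact H.
  - apply Hf in H; exact H.
Qed.

Lemma def_or Q Q' :
  definable Q -> definable Q' -> definable (fun e => Q e \/ Q' e).
Proof.
  intros H H'; apply (definable_ext _ (fun e => ~ (~ Q e /\ ~ Q' e))).
  - intro e; tauto.
  - apply def_not, def_and; apply def_not; assumption.
Qed.

Lemma def_imp Q Q' :
  definable Q -> definable Q' -> definable (fun e => Q e -> Q' e).
Proof.
  intros H H'; apply (definable_ext _ (fun e => ~ (Q e /\ ~ Q' e))).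
  - intro e; tauto.
  - apply def_not, def_and; [| apply def_not]; assumption.
Qed.

Lemma def_ex (Q : (nat -> V) -> V -> Prop) :
  definable (fun e => Q (fun n => e (S n)) (e 0)) ->
  definable (fun e => exists x, Q e x).
Proof.
  intro H; apply (definable_ext _ (fun e => ~ forall x, ~ Q e x)).
  - intro e; split.
    + intros [x Hx] Hn; exact (Hn x Hx).
    + apply not_all_not_ex.
  - apply def_not, def_all, def_not, H.
Qed.

Lemma def_const (A : Prop) : definable (fun _ => A).
Proof.
  (* This supplies some class to fill the parameter sequence. *)
  destruct (gbc_global_choice HM) as (X & _); exists (fun _ => X).
  destruct (classic A) as [HA | HA].
  - exists (FAll (FEq 0 0)); simpl; tauto.
  - exists (FNeg (FAll (FEq 0 0))); simpl; intro e; split; [tauto |].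
    intro H; exfalso; apply H; reflexivity.
Qed.

Lemma dt_var n : dterm (fun e => e n).
Proof.
  destruct (gbc_global_choice HM) as (X & _).
  exists (fun _ => X), (FEq 0 (S n)); intro e; reflexivity.
Qed.

(** A set parameter is turned into the class [{c}], obtained by comprehension with [c] in the
    environment. *)
Lemma dt_const c : dterm (fun _ => c).
Proof.
  destruct (gbc_global_choice HM) as (X & _).
  destruct (gbc_comprehension HM (FEq 0 1) (fun _ => X) (fun _ => c)) as (Y & HY).
  exists (fun _ => Y), (FCls 0 0); intro e; simpl.
  symmetry; apply HY.
Qed.

Lemma def1 (Q : V -> Prop) t :
  definable (fun e => Q (e 0)) -> dterm t -> definable (fun e => Q (t e)).
Proof.
  intros HQ Ht.
  apply (definable_ext _ (fun e => exists x : V, x = t e /\ Q x)).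
  - intro e; split; [intro; exists (t e); auto | intros (x & -> & H); exact H].
  - apply def_ex, def_and; assumption.
Qed.

(** Substitution by naming the values of the terms. The last term is bound outermost, so that under
    the quantifiers the arguments stand in variables 0 and 1; the other term is shifted past the
    binder by [dt_ren]. *)
Lemma def2 (Q : V -> V -> Prop) t u :
  definable (fun e => Q (e 0) (e 1)) -> dterm t -> dterm u ->
  definable (fun e => Q (t e) (u e)).
Proof.
  intros HQ Ht Hu.
  apply (definable_ext _ (fun e => exists y : V, y = u e /\ exists x : V, x = t e /\ Q x y)).
  - intro e; split.
    + intro; exists (u e); split; [| exists (t e)]; auto.
    + intros (y & -> & x & -> & H); exact H.
  - apply def_ex, def_and; [exact Hu |].
    apply def_ex, def_and; [| exact HQ].
    exact (dt_ren t S Ht).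
Qed.

Lemma def3 (Q : V -> V -> V -> Prop) t u v :
  definable (fun e => Q (e 0) (e 1) (e 2)) -> dterm t -> dterm u -> dterm v ->
  definable (fun e => Q (t e) (u e) (v e)).
Proof.
  intros HQ Ht Hu Hv.
  apply (definable_ext _ (fun e => exists z : V, z = v e /\
           exists y : V, y = u e /\ exists x : V, x = t e /\ Q x y z)).
  - intro e; split.
    + intro; exists (v e); split; [| exists (u e); split; [| exists (t e)]]; auto.
    + intros (z & -> & y & -> & x & -> & H); exact H.
  - apply def_ex, def_and; [exact Hv |].
    apply def_ex, def_and; [exact (dt_ren u S Hu) |].
    apply def_ex, def_and; [exact (dt_ren t (fun n => S (S n)) Ht) | exact HQ].
Qed.

Lemma dt_fun1 (g : V -> V) t :
  definable (fun e => e 0 = g (e 1)) -> dterm t -> dterm (fun e => g (t e)).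
Proof.
  intros Hg Ht; unfold dterm.
  apply (def2 (fun x y => x = g y) (fun e => e 0)); [exact Hg | apply dt_var |].
  exact (dt_ren t S Ht).
Qed.

Lemma dt_fun2 (g : V -> V -> V) t u :
  definable (fun e => e 0 = g (e 1) (e 2)) -> dterm t -> dterm u ->
  dterm (fun e => g (t e) (u e)).
Proof.
  intros Hg Ht Hu; unfold dterm.
  apply (def3 (fun x y z => x = g y z) (fun e => e 0)); [exact Hg | apply dt_var | |].
  - exact (dt_ren t S Ht).
  - exact (dt_ren u S Hu).
Qed.

Lemma def_mem t u : dterm t -> dterm u -> definable (fun e => t e ∈ u e).
Proof.
  apply (def2 (fun x y => x ∈ y)).
  destruct (gbc_global_choice HM) as (X & _).
  exists (fun _ => X), (FMem 0 1); intro e; reflexivity.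
Qed.

Lemma def_eq t u : dterm t -> dterm u -> definable (fun e => t e = u e).
Proof. apply (def2 (fun x y => x = y)); exact (dt_var 0). Qed.

Lemma def_cls (X : Class) t : dterm t -> definable (fun e => X (t e)).
Proof.
  apply def1; exists (fun _ => X), (FCls 0 0); intro e; reflexivity.
Qed.

(* The unique witness of [Q], and the empty set if there is none. *)
Definition iota (Q : V -> Prop) : V :=
  epsilon inhabited_V (fun x =>
    ((exists! y, Q y) -> Q x) /\ (~ (exists! y, Q y) -> is_empty x)).

Lemma empty_exists : exists z : V, is_empty z.
Proof. destruct (gbc_infinity HM) as (u & (z & Hz & _) & _); exists z; exact Hz. Qed.

Lemma iota_cases Q :
  ((exists! y, Q y) -> Q (iota Q)) /\ (~ (exists! y, Q y) -> is_empty (iota Q)).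
Proof.
  unfold iota; apply epsilon_spec.
  destruct (classic (exists! y, Q y)) as [H | H].
  - destruct H as (y & Hy & Hu); exists y; split; [tauto |].
    intro N; exfalso; apply N; exists y; split; assumption.
  - destruct empty_exists as (z & Hz); exists z; tauto.
Qed.

Lemma iota_spec Q : (exists x, Q x) -> (forall x y, Q x -> Q y -> x = y) -> Q (iota Q).
Proof.
  intros (x & Hx) Hu; apply iota_cases; exists x; split; [exact Hx |].
  intros y Hy; apply Hu; assumption.
Qed.

Lemma set_ext (x y : V) : (forall z, z ∈ x <-> z ∈ y) -> x = y.
Proof. apply (gbc_set_ext HM). Qed.

(** Since the default value is the empty set, the graph of [iota] splits into two first-order cases:
    a unique witness exists and is the value, or it does not and the value has no elements. *)
Lemma dt_iota (Q : (nat -> V) -> V -> Prop) :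
  definable (fun e => Q (fun n => e (S n)) (e 0)) -> dterm (fun e => iota (Q e)).
Proof.
  intro H; unfold dterm.
  assert (Hx : definable (fun e => Q (fun n => e (S (S n))) (e 0))).
  { exact (def_ren _ (fun n => match n with 0 => 0 | S m => S (S m) end) H). }
  assert (Hx1 : definable (fun e => Q (fun n => e (S (S (S n)))) (e 0))).
  { exact (def_ren _ (fun n => match n with 0 => 0 | S m => S (S (S m)) end) H). }
  assert (Hx2 : definable (fun e => Q (fun n => e (S (S (S n)))) (e 1))).
  { exact (def_ren _ (fun n => match n with 0 => 1 | S m => S (S (S m)) end) H). }
  apply (definable_ext _ (fun e =>
    ((exists y, Q (fun n => e (S n)) y /\ forall z, Q (fun n => e (S n)) z -> y = z)
       /\ Q (fun n => e (S n)) (e 0)) \/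
    (~ (exists y, Q (fun n => e (S n)) y /\ forall z, Q (fun n => e (S n)) z -> y = z)
       /\ forall w, ~ w ∈ e 0))).
  - intro e; pose proof (iota_cases (Q (fun n => e (S n)))) as [H1 H2]; split.
    + intros ->; destruct (classic (exists! y, Q (fun n => e (S n)) y)) as [U | U].
      * left; split; [exact U | exact (H1 U)].
      * right; split; [exact U | exact (H2 U)].
    + intros [(U & HQ) | (U & HQ)].
      * specialize (H1 U); destruct U as (y & Hy & Hu).
        rewrite <- (Hu _ HQ), <- (Hu _ H1); reflexivity.
      * specialize (H2 U); apply set_ext; intro z; split; intro Hz; exfalso.
        -- exact (HQ _ Hz).
        -- exact (H2 _ Hz).
  - apply def_or; apply def_and.
    + apply def_ex, def_and; [exact Hx |].
      apply def_all, def_imp; [exact Hx1 | apply def_eq; apply dt_var].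
    + exact H.
    + apply def_not, def_ex, def_and; [exact Hx |].
      apply def_all, def_imp; [exact Hx1 | apply def_eq; apply dt_var].
    + apply def_all, def_not, def_mem; apply dt_var.
Qed.

Definition isset (Q : V -> Prop) : Prop := exists z, forall w, w ∈ z <-> Q w.

Definition setof (Q : V -> Prop) : V := iota (fun z => forall w, w ∈ z <-> Q w).

Lemma in_setof Q : isset Q -> forall w, w ∈ setof Q <-> Q w.
Proof.
  intro H; apply (iota_spec (fun z => forall w, w ∈ z <-> Q w)); [exact H |].
  intros x y Hx Hy; apply set_ext; intro z; rewrite Hx, Hy; reflexivity.
Qed.

Lemma setof_ext Q Q' : (forall w, Q w <-> Q' w) -> setof Q = setof Q'.
Proof.
  intro H; f_equal; apply functional_extensionality; intro w.
  apply propositional_extensionality, H.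
Qed.

Lemma dt_setof (Q : (nat -> V) -> V -> Prop) :
  definable (fun e => Q (fun n => e (S n)) (e 0)) -> dterm (fun e => setof (Q e)).
Proof.
  intro H; unfold setof; apply (dt_iota (fun e z => forall w, w ∈ z <-> Q e w)).
  assert (H' := def_ren _ (fun n => match n with 0 => 0 | S m => S (S m) end) H).
  apply def_all, def_and; apply def_imp; try exact H'; apply def_mem; apply dt_var.
Qed.

(* extended below, as new definitions become available *)
Ltac def_pairing := fail.
Ltac def_sets := fail.
Ltac def_rank := fail.
Ltac def_forcing := fail.

(** Recursion on the syntax of the predicate. Expressions that ignore the environment are settled
    first; predicates and functions without known syntax are looked up among the hypotheses, stated
    there for the arguments [e 0], [e 1], [e 2]. *)
Ltac def_step :=
  cbv beta;
  lazymatch goal with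
  | |- definable (fun _ => ?A) => exact (def_const A)
  | |- definable (fun e => @?A e /\ @?B e) => refine (def_and A B _ _)
  | |- definable (fun e => @?A e \/ @?B e) => refine (def_or A B _ _)
  | |- definable (fun e => ~ @?A e) => refine (def_not A _)
  | |- definable (fun e => @?A e <-> @?B e) =>
      refine (def_and (fun e => A e -> B e) (fun e => B e -> A e) _ _)
  | |- definable (fun e => @?A e -> @?B e) => refine (def_imp A B _ _)
  | |- definable (fun e => forall x : _, @?A e x) => refine (def_all A _)
  | |- definable (fun e => @ex _ (@?A e)) => refine (def_ex A _)
  | |- definable (fun e => mem (@?t e) (@?u e)) => refine (def_mem t u _ _)
  | |- definable (fun e => @eq _ (@?t e) (@?u e)) => refine (def_eq t u _ _)
  | |- definable (fun e => cmem ?X (@?t e)) => refine (def_cls X t _)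
  | |- dterm (fun e => e ?n) => exact (dt_var n)
  | |- dterm (fun _ => ?c) => exact (dt_const c)
  | |- dterm (fun e => setof (@?Q e)) => refine (dt_setof Q _)
  | |- dterm (fun e => iota (@?Q e)) => refine (dt_iota Q _)
  | |- _ => first
    [ def_pairing | def_sets | def_rank | def_forcing
    | match goal with
      | H : definable (fun e => ?Q (e 0)) |- definable (fun e => ?Q (@?t e)) =>
          refine (def1 Q t H _)
      | H : definable (fun e => ?Q (e 0) (e 1))
        |- definable (fun e => ?Q (@?t e) (@?u e)) => refine (def2 Q t u H _ _)
      | H : definable (fun e => ?Q (e 0) (e 1) (e 2))
        |- definable (fun e => ?Q (@?t e) (@?u e) (@?v e)) =>
          refine (def3 Q t u v H _ _ _)
      | H : definable (fun e => e 0 = ?g (e 1)) |- dterm (fun e => ?g (@?t e)) =>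
          refine (dt_fun1 g t H _)
      | H : definable (fun e => e 0 = ?g (e 1) (e 2))
        |- dterm (fun e => ?g (@?t e) (@?u e)) => refine (dt_fun2 g t u H _ _)
      end
    | assumption ]
  end.

Ltac def := repeat def_step.

(** * Sets, pairs and replacement *)

Lemma isset_upair x y : isset (fun w => w = x \/ w = y).
Proof. exact (gbc_pairing HM x y). Qed.

Definition upair (x y : V) : V := setof (fun w => w = x \/ w = y).
Definition opair (x y : V) : V := upair (upair x x) (upair x y).

Lemma in_upair w x y : w ∈ upair x y <-> w = x \/ w = y.
Proof. apply (in_setof _ (isset_upair x y)). Qed.

Lemma is_upair_eq z x y : is_upair z x y <-> z = upair x y.
Proof.
  split.
  - intro H; apply set_ext; intro w; rewrite in_upair; apply H.
  - intros -> w; apply in_upair.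
Qed.

Lemma is_opair_eq z x y : is_opair z x y <-> z = opair x y.
Proof.
  unfold is_opair; split.
  - intros (s & d & Hs & Hd & Hz).
    apply is_upair_eq in Hs, Hd, Hz; subst; reflexivity.
  - intros ->; exists (upair x x), (upair x y); rewrite !is_upair_eq; auto.
Qed.

Lemma upair_singleton x y z : upair x y = upair z z -> x = z /\ y = z.
Proof.
  intro H; split.
  - assert (Hx : x ∈ upair z z) by (rewrite <- H, in_upair; auto).
    apply in_upair in Hx; tauto.
  - assert (Hy : y ∈ upair z z) by (rewrite <- H, in_upair; auto).
    apply in_upair in Hy; tauto.
Qed.

Lemma opair_inj x y x' y' : opair x y = opair x' y' -> x = x' /\ y = y'.
Proof.
  intro H.
  assert (E : x = x').
  { assert (Hx : upair x x ∈ opair x' y') by (rewrite <- H; apply in_upair; auto).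
    apply in_upair in Hx; destruct Hx as [Hx | Hx].
    - apply upair_singleton in Hx; tauto.
    - symmetry in Hx; apply upair_singleton in Hx; symmetry; tauto. }
  subst x'; split; [reflexivity |].
  assert (Hy : upair x y ∈ opair x y') by (rewrite <- H; apply in_upair; auto).
  assert (Hy' : upair x y' ∈ opair x y) by (rewrite H; apply in_upair; auto).
  apply in_upair in Hy, Hy'.
  assert (A : y = x \/ y = y').
  { destruct Hy as [Hy | Hy].
    - apply upair_singleton in Hy; tauto.
    - assert (K : y ∈ upair x y') by (rewrite <- Hy; apply in_upair; auto).
      apply in_upair in K; tauto. }
  assert (A' : y' = x \/ y' = y).
  { destruct Hy' as [Hy' | Hy'].
    - apply upair_singleton in Hy'; tauto.
    - assert (K : y' ∈ upair x y) by (rewrite <- Hy'; apply in_upair; auto).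
      apply in_upair in K; tauto. }
  destruct A as [-> | ->]; [| reflexivity].
  destruct A' as [-> | ->]; reflexivity.
Qed.

Lemma rel_eq R x y : rel R x y <-> R (opair x y).
Proof.
  unfold rel; split.
  - intros (z & Hz & H); apply is_opair_eq in Hz; subst; exact H.
  - intro H; exists (opair x y); rewrite is_opair_eq; auto.
Qed.

Lemma rel3_eq R x y z : rel3 R x y z <-> R (opair x (opair y z)).
Proof.
  unfold rel3; split.
  - intros (w & Hw & H); apply is_opair_eq in Hw; subst; apply rel_eq; exact H.
  - intro H; exists (opair y z); rewrite is_opair_eq, rel_eq; auto.
Qed.

Lemma setrel_eq f x y : setrel f x y <-> opair x y ∈ f.
Proof.
  unfold setrel; split.
  - intros (z & Hz & H); apply is_opair_eq in Hz; subst; exact H.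
  - intro H; exists (opair x y); rewrite is_opair_eq; auto.
Qed.

Lemma dt_upair t u : dterm t -> dterm u -> dterm (fun e => upair (t e) (u e)).
Proof. apply dt_fun2; unfold upair; def. Qed.

Lemma dt_opair t u : dterm t -> dterm u -> dterm (fun e => opair (t e) (u e)).
Proof. intros; unfold opair; repeat apply dt_upair; assumption. Qed.

Lemma def_opair z t u :
  dterm z -> dterm t -> dterm u -> definable (fun e => is_opair (z e) (t e) (u e)).
Proof.
  intros; apply (definable_ext _ (fun e => z e = opair (t e) (u e))).
  - intro e; apply is_opair_eq.
  - apply def_eq; [| apply dt_opair]; assumption.
Qed.

Lemma def_rel R t u : dterm t -> dterm u -> definable (fun e => rel R (t e) (u e)).
Proof.
  intros; apply (definable_ext _ (fun e => R (opair (t e) (u e)))).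
  - intro e; apply rel_eq.
  - apply def_cls, dt_opair; assumption.
Qed.

Lemma def_rel3 R t u v :
  dterm t -> dterm u -> dterm v -> definable (fun e => rel3 R (t e) (u e) (v e)).
Proof.
  intros; apply (definable_ext _ (fun e => R (opair (t e) (opair (u e) (v e))))).
  - intro e; apply rel3_eq.
  - apply def_cls; repeat apply dt_opair; assumption.
Qed.

Lemma def_setrel f t u :
  dterm f -> dterm t -> dterm u -> definable (fun e => setrel (f e) (t e) (u e)).
Proof.
  intros; apply (definable_ext _ (fun e => opair (t e) (u e) ∈ f e)).
  - intro e; apply setrel_eq.
  - apply def_mem; [apply dt_opair |]; assumption.
Qed.

Ltac def_pairing ::=
  lazymatch goal with
  | |- dterm (fun e => upair (@?t e) (@?u e)) => refine (dt_upair t u _ _)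
  | |- dterm (fun e => opair (@?t e) (@?u e)) => refine (dt_opair t u _ _)
  | |- definable (fun e => is_opair (@?z e) (@?t e) (@?u e)) =>
      refine (def_opair z t u _ _ _)
  | |- definable (fun e => rel ?R (@?t e) (@?u e)) => refine (def_rel R t u _ _)
  | |- definable (fun e => rel3 ?R (@?t e) (@?u e) (@?v e)) =>
      refine (def_rel3 R t u v _ _ _)
  | |- definable (fun e => setrel (@?f e) (@?t e) (@?u e)) =>
      refine (def_setrel f t u _ _ _)
  end.

Lemma isset_image (Q : V -> V -> Prop) a :
  definable (fun e => Q (e 0) (e 1)) ->
  (forall x y y', Q x y -> Q x y' -> y = y') ->
  isset (fun y => exists x, x ∈ a /\ Q x y).
Proof.
  intros HQ Hf.
  destruct (class_of (fun z => exists x y, z = opair x y /\ Q x y)) as (F & HF);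
    [def |].
  assert (E : forall x y, rel F x y <-> Q x y).
  { intros x y; rewrite rel_eq, HF; split.
    - intros (x' & y' & H & HH); apply opair_inj in H; destruct H; subst; exact HH.
    - intro; exists x, y; auto. }
  destruct (@gbc_replacement M HM F a) as (b & Hb).
  - intros x y y'; rewrite !E; apply Hf.
  - exists b; intro y; rewrite Hb; split; intros (x & Hx & H); exists x;
      apply E in H || apply <- E in H; auto.
Qed.

Lemma isset_fun_image (g : V -> V) a :
  definable (fun e => e 0 = g (e 1)) -> isset (fun y => exists x, x ∈ a /\ y = g x).
Proof.
  intro Hg; apply (isset_image (fun x y => y = g x)).
  - def.
  - intros; subst; reflexivity.
Qed.

(** Separation is replacement along the partial identity on [Q], with [a] as a bound. *)
Lemma isset_sep (Q : V -> Prop) a :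
  definable (fun e => Q (e 0)) -> (forall x, Q x -> x ∈ a) -> isset Q.
Proof.
  intros HQ Ha.
  destruct (isset_image (fun x y => x = y /\ Q x) a) as (b & Hb).
  - def.
  - intros x y y' [] []; congruence.
  - exists b; intro w; rewrite Hb; split.
    + intros (x & _ & -> & H); exact H.
    + intro H; exists w; auto.
Qed.

Definition union (a : V) : V := setof (fun z => exists y, y ∈ a /\ z ∈ y).
Definition power (a : V) : V := setof (fun z => forall w, w ∈ z -> w ∈ a).
Definition cup (a b : V) : V := union (upair a b).

Lemma in_union z a : z ∈ union a <-> exists y, y ∈ a /\ z ∈ y.
Proof. apply (in_setof _ (gbc_union HM a)). Qed.

Lemma in_power z a : z ∈ power a <-> forall w, w ∈ z -> w ∈ a.
Proof. apply (in_setof _ (gbc_power HM a)). Qed.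

Lemma in_cup z a b : z ∈ cup a b <-> z ∈ a \/ z ∈ b.
Proof.
  unfold cup; rewrite in_union; split.
  - intros (y & Hy & Hz); apply in_upair in Hy; destruct Hy; subst; auto.
  - intros [H | H]; [exists a | exists b]; rewrite in_upair; auto.
Qed.

Lemma dt_union t : dterm t -> dterm (fun e => union (t e)).
Proof. apply dt_fun1; unfold union; def. Qed.

Lemma dt_cup t u : dterm t -> dterm u -> dterm (fun e => cup (t e) (u e)).
Proof. intros; apply dt_union, dt_upair; assumption. Qed.

Definition empty : V := setof (fun _ => False).

Lemma in_empty z : ~ z ∈ empty.
Proof.
  unfold empty; rewrite in_setof; [tauto |].
  destruct empty_exists as (x & Hx); exists x; intro w; split; [apply Hx | tauto].
Qed.

Lemma empty_eq z : is_empty z <-> z = empty.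
Proof.
  split.
  - intro H; apply set_ext; intro w; split; intro Hw; exfalso;
      [exact (H _ Hw) | exact (in_empty _ Hw)].
  - intros -> w; apply in_empty.
Qed.

Lemma mem_asym x y : x ∈ y -> ~ y ∈ x.
Proof.
  intros H H'.
  destruct (@gbc_foundation M HM (upair x y) x) as (z & Hz & Hm); [apply in_upair; auto |].
  apply in_upair in Hz; destruct Hz as [-> | ->].
  - apply (Hm y H'); apply in_upair; auto.
  - apply (Hm x H); apply in_upair; auto.
Qed.

Definition succ (y : V) : V := cup y (upair y y).

Lemma in_succ w y : w ∈ succ y <-> w ∈ y \/ w = y.
Proof. unfold succ; rewrite in_cup, in_upair; tauto. Qed.

Lemma succ_eq z y : is_succ z y <-> z = succ y.
Proof.
  split.
  - intro H; apply set_ext; intro w; rewrite in_succ; apply H.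
  - intros -> w; apply in_succ.
Qed.

Lemma succ_inj x y : succ x = succ y -> x = y.
Proof.
  intro H.
  assert (Hx : x ∈ succ y) by (rewrite <- H, in_succ; auto).
  assert (Hy : y ∈ succ x) by (rewrite H, in_succ; auto).
  apply in_succ in Hx, Hy.
  destruct Hx as [Hx | Hx]; [| exact Hx]; destruct Hy as [Hy | Hy]; [| auto].
  exfalso; exact (mem_asym _ _ Hx Hy).
Qed.

Lemma succ_nonempty x : succ x <> empty.
Proof. intro H; apply (in_empty x); rewrite <- H; apply in_succ; auto. Qed.

Lemma dt_succ t : dterm t -> dterm (fun e => succ (t e)).
Proof. intros; apply dt_cup; [| apply dt_upair]; assumption. Qed.

Ltac def_sets ::=
  lazymatch goal with
  | |- dterm (fun e => union (@?t e)) => refine (dt_union t _)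
  | |- dterm (fun e => succ (@?t e)) => refine (dt_succ t _)
  end.

(** * Transitive supersets, rank comparison and recursion *)

(** The omega of the model, as the intersection of all inductive sets. It may have nonstandard
    elements, so [nat] cannot stand in for it. *)
Definition isnat (n : V) : Prop :=
  forall u, empty ∈ u -> (forall y, y ∈ u -> succ y ∈ u) -> n ∈ u.

Lemma isset_nat : isset isnat.
Proof.
  destruct (gbc_infinity HM) as (u & (z & Hz & Hzu) & Hs).
  apply (isset_sep _ u); [unfold isnat; def |].
  intros n Hn; apply Hn.
  - apply empty_eq in Hz; subst; exact Hzu.
  - intros y Hy; destruct (Hs y Hy) as (s & Hsy & Hsu).
    apply succ_eq in Hsy; subst; exact Hsu.
Qed.

Lemma isnat_ind (Q : V -> Prop) :
  definable (fun e => Q (e 0)) -> Q empty ->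
  (forall n, isnat n -> Q n -> Q (succ n)) -> forall n, isnat n -> Q n.
Proof.
  intros HQ H0 HS n Hn.
  destruct isset_nat as (o & Ho).
  assert (Hd : isset (fun n => n ∈ o /\ Q n)).
  { apply (isset_sep _ o); [def | tauto]. }
  destruct Hd as (u & Hu); apply (Hu n), Hn.
  - apply Hu; split; [apply Ho; intros v Hv _; exact Hv | exact H0].
  - intros y Hy; apply Hu in Hy; destruct Hy as [Hy HQy]; apply Ho in Hy.
    apply Hu; split; [| apply HS; assumption].
    apply Ho; intros v Hv Hvs; apply Hvs, Hy; assumption.
Qed.

(* [y] is the [n]-fold union of [x] *)
Definition iter_union (x n y : V) : Prop :=
  exists f, opair n y ∈ f /\ forall a b, opair a b ∈ f ->
    (a = empty /\ b = x) \/
    exists a' b', a = succ a' /\ opair a' b' ∈ f /\ b = union b'.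

Lemma iter_union_0 x : iter_union x empty x.
Proof.
  exists (upair (opair empty x) (opair empty x)); split; [apply in_upair; auto |].
  intros a b H; left; apply in_upair in H.
  destruct H as [H | H]; apply opair_inj in H; exact H.
Qed.

Lemma iter_union_S x n y : iter_union x n y -> iter_union x (succ n) (union y).
Proof.
  intros (f & Hf & Hc).
  set (p := opair (succ n) (union y)).
  exists (cup f (upair p p)); split; [rewrite in_cup, in_upair; auto |].
  intros a b H; apply in_cup in H; destruct H as [H | H].
  - destruct (Hc a b H) as [H' | (a' & b' & E1 & H' & E2)]; [left; exact H' |].
    right; exists a', b'; rewrite in_cup; auto.
  - right; exists n, y; rewrite in_cup.
    apply in_upair in H; destruct H as [H | H]; apply opair_inj in H; tauto.
Qed.

Lemma iter_union_unique x n :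
  isnat n -> forall y y', iter_union x n y -> iter_union x n y' -> y = y'.
Proof.
  revert n; apply (isnat_ind (fun n =>
    forall y y', iter_union x n y -> iter_union x n y' -> y = y')).
  - unfold iter_union; def.
  - assert (E : forall y, iter_union x empty y -> y = x).
    { intros y (f & Hf & Hc); destruct (Hc _ _ Hf) as [[_ H] | (a' & b' & H & _)];
        [exact H |].
      symmetry in H; apply succ_nonempty in H; destruct H. }
    intros y y' H H'; rewrite (E y H), (E y' H'); reflexivity.
  - intros n _ IH.
    assert (E : forall y, iter_union x (succ n) y ->
                  exists z, iter_union x n z /\ y = union z).
    { intros y (f & Hf & Hc); destruct (Hc _ _ Hf) as [[H _] | (a' & b' & H & Hf' & E)].
      - apply succ_nonempty in H; destruct H.
      - apply succ_inj in H; subst a'; exists b'; split; [exists f; auto | exact E]. }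
    intros y y' H H'.
    destruct (E y H) as (z & Hz & ->), (E y' H') as (z' & Hz' & ->).
    rewrite (IH z z' Hz Hz'); reflexivity.
Qed.

(** The union of all iterated unions of [x], collected by replacement over the omega of the model.
    Passing to an element of an element costs one more iteration. *)
Lemma transitive_superset x :
  exists t, (forall z, z ∈ x -> z ∈ t) /\ (forall y z, y ∈ t -> z ∈ y -> z ∈ t).
Proof.
  destruct isset_nat as (o & Ho).
  destruct (isset_image (fun n y => isnat n /\ iter_union x n y) o) as (s & Hs).
  - unfold isnat, iter_union; def.
  - intros n y y' [Hn H] [_ H']; exact (iter_union_unique x n Hn y y' H H').
  - exists (union s); split.
    + intros z Hz; apply in_union; exists x; split; [| exact Hz].
      apply Hs; exists empty; rewrite Ho.
      assert (isnat empty) by (intros v Hv _; exact Hv).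
      auto using iter_union_0.
    + intros y z Hy Hz; apply in_union in Hy; destruct Hy as (w & Hw & Hy).
      apply Hs in Hw; destruct Hw as (n & _ & Hn & H).
      apply in_union; exists (union w); split; [| apply in_union; exists y; auto].
      apply Hs; exists (succ n).
      assert (isnat (succ n)) by (intros v Hv Hvs; apply Hvs, Hn; assumption).
      rewrite Ho; auto using iter_union_S.
Qed.

(** The foundation axiom speaks of sets. Inside a transitive superset the counterexamples to [Q]
    form a set, and a minimal one contradicts the induction step. *)
Lemma mem_ind (Q : V -> Prop) :
  definable (fun e => Q (e 0)) ->
  (forall x, (forall y, y ∈ x -> Q y) -> Q x) -> forall x, Q x.
Proof.
  intros HQ Hstep x; apply NNPP; intro Hx.
  destruct (transitive_superset (upair x x)) as (t & Ht & Htr).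
  destruct (isset_sep (fun z => z ∈ t /\ ~ Q z) t) as (s & Hs); [def | tauto |].
  destruct (@gbc_foundation M HM s x) as (z & Hz & Hmin).
  - apply Hs; split; [apply Ht, in_upair; auto | exact Hx].
  - apply Hs in Hz; destruct Hz as [Hzt Hz]; apply Hz, Hstep.
    intros y Hy; apply NNPP; intro Hn; apply (Hmin y Hy), Hs.
    split; [exact (Htr z y Hzt Hy) | exact Hn].
Qed.

(* Comparison of von Neumann ranks, expressed by simulations. *)
Definition rle (x y : V) : Prop :=
  exists R, opair x y ∈ R /\
    forall a b, opair a b ∈ R -> forall a', a' ∈ a -> exists b', b' ∈ b /\ opair a' b' ∈ R.

Definition rlt (x y : V) : Prop := exists b, b ∈ y /\ rle x b.

Lemma def_rle t u : dterm t -> dterm u -> definable (fun e => rle (t e) (u e)).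
Proof. apply def2; unfold rle; def. Qed.

Lemma def_rlt t u : dterm t -> dterm u -> definable (fun e => rlt (t e) (u e)).
Proof. apply def2; unfold rlt; apply def_ex, def_and; [def | apply def_rle; def]. Qed.

Ltac def_rank ::=
  lazymatch goal with
  | |- definable (fun e => rle (@?t e) (@?u e)) => refine (def_rle t u _ _)
  | |- definable (fun e => rlt (@?t e) (@?u e)) => refine (def_rlt t u _ _)
  end.

Lemma isset_product (Q : V -> V -> Prop) t :
  definable (fun e => Q (e 0) (e 1)) ->
  isset (fun z => exists a b, z = opair a b /\ a ∈ t /\ b ∈ t /\ Q a b).
Proof.
  intro HQ; apply (isset_sep _ (power (power t))); [def |].
  intros z (a & b & -> & Ha & Hb & _); apply in_power; intros w Hw; apply in_power.
  apply in_upair in Hw; intros v Hv; destruct Hw; subst w; apply in_upair in Hv;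
    destruct Hv; subst; assumption.
Qed.

(** For the converse, the pairs in a transitive set that satisfy the right-hand side form a
    simulation themselves, by the forward direction. *)
Lemma rle_unfold x y : rle x y <-> forall a, a ∈ x -> rlt a y.
Proof.
  assert (H1 : forall x y, rle x y -> forall a, a ∈ x -> rlt a y).
  { intros x0 y0 (R & HR & Hs) a Ha; destruct (Hs _ _ HR a Ha) as (b & Hb & Hab).
    exists b; split; [exact Hb |]; exists R; auto. }
  split; [apply H1 |]; intro H.
  destruct (transitive_superset (upair x y)) as (t & Ht & Htr).
  destruct (isset_product (fun a b => forall a', a' ∈ a -> rlt a' b) t) as (R & HR);
    [def |].
  exists R; split.
  - apply HR; exists x, y; repeat split; try exact H; apply Ht, in_upair; auto.
  - intros a b Hab a' Ha'; apply HR in Hab.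
    destruct Hab as (a0 & b0 & E & Ha & Hb & Hs); apply opair_inj in E.
    destruct E; subst a0 b0; destruct (Hs a' Ha') as (b' & Hb' & Hab').
    exists b'; split; [exact Hb' |]; apply HR; exists a', b'.
    repeat split; eauto.
Qed.

Lemma rle_refl x : rle x x.
Proof.
  revert x; apply (mem_ind (fun x => rle x x)); [def |].
  intros x IH; apply rle_unfold; intros a Ha; exists a; auto.
Qed.

Lemma rlt_mem x y : x ∈ y -> rlt x y.
Proof. intro H; exists x; split; [exact H | apply rle_refl]. Qed.

Lemma rle_trans x y z : rle x y -> rle y z -> rle x z.
Proof.
  revert x y z.
  apply (mem_ind (fun x => forall y z, rle x y -> rle y z -> rle x z)); [def |].
  intros x IH y z Hxy Hyz; apply rle_unfold; intros a Ha.
  rewrite rle_unfold in Hxy, Hyz; destruct (Hxy a Ha) as (b & Hb & Hab).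
  destruct (Hyz b Hb) as (c & Hc & Hbc); exists c; eauto.
Qed.

Lemma rlt_rle x y : rlt x y -> rle x y.
Proof.
  assert (H : forall b y, b ∈ y -> rle b y).
  { apply (mem_ind (fun b => forall y, b ∈ y -> rle b y)); [def |].
    intros b IH y' Hb; apply rle_unfold; intros a Ha; exists b; auto. }
  intros (b & Hb & Hx); apply (rle_trans x b y); auto.
Qed.

Lemma rle_rlt_trans x y z : rle x y -> rlt y z -> rlt x z.
Proof. intros H (b & Hb & Hy); exists b; split; [exact Hb | exact (rle_trans _ _ _ H Hy)]. Qed.

Lemma rlt_rle_trans x y z : rlt x y -> rle y z -> rlt x z.
Proof.
  intros (b & Hb & Hx) H; rewrite rle_unfold in H.
  exact (rle_rlt_trans _ _ _ Hx (H b Hb)).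
Qed.

Lemma rlt_trans x y z : rlt x y -> rlt y z -> rlt x z.
Proof. intros H H'; exact (rle_rlt_trans _ _ _ (rlt_rle _ _ H) H'). Qed.

(** If [rle x y] fails, some [a] in [x] is bounded by no element of [y]. By induction every element
    of [y] then has rank below [a], so [y] is bounded by [a]. *)
Lemma rle_or_rlt x y : rle x y \/ rlt y x.
Proof.
  revert y x; apply (mem_ind (fun y => forall x, rle x y \/ rlt y x)); [def |].
  intros y IH x; destruct (classic (rle x y)) as [H | H]; [auto | right].
  rewrite rle_unfold in H; apply not_all_ex_not in H; destruct H as (a & H).
  apply imply_to_and in H; destruct H as [Ha H].
  exists a; split; [exact Ha |]; apply rle_unfold; intros b Hb.
  destruct (IH b Hb a) as [Hab | Hba]; [| exact Hba].
  exfalso; apply H; exists b; auto.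
Qed.

(** A level of the cumulative hierarchy: a set of rank at most that of [y] is a subset of the union
    of the levels belonging to the elements of [y]. *)
Lemma isset_rle y : isset (fun x => rle x y).
Proof.
  set (g := fun b => setof (fun x => rle x b)).
  assert (Hg : definable (fun e => e 0 = g (e 1))) by (unfold g; def).
  revert y; apply (mem_ind (fun y => isset (fun x => rle x y))); [unfold isset; def |].
  intros y IH; destruct (isset_fun_image g y Hg) as (s & Hs).
  apply (isset_sep _ (power (union s))); [def |].
  intros x Hx; apply in_power; intros a Ha; rewrite rle_unfold in Hx.
  destruct (Hx a Ha) as (b & Hb & Hab); apply in_union; exists (g b); split.
  - apply Hs; exists b; auto.
  - apply (in_setof _ (IH b Hb)); exact Hab.
Qed.

Lemma rlt_ind (Q : V -> Prop) :
  definable (fun e => Q (e 0)) ->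
  (forall x, (forall y, rlt y x -> Q y) -> Q x) -> forall x, Q x.
Proof.
  intros HQ Hstep.
  assert (H : forall x y, rle y x -> Q y).
  { apply (mem_ind (fun x => forall y, rle y x -> Q y)); [def |].
    intros x IH y Hy; apply Hstep; intros z Hz.
    destruct (rlt_rle_trans z y x Hz Hy) as (b & Hb & Hzb); eauto. }
  intro x; exact (H x x (rle_refl x)).
Qed.

Lemma rank_minimal (Q : V -> Prop) :
  definable (fun e => Q (e 0)) -> (exists x, Q x) ->
  exists x, Q x /\ forall y, Q y -> rle x y.
Proof.
  intros HQ (x & Hx); apply NNPP; intro Hn; revert x Hx.
  apply (rlt_ind (fun x => ~ Q x)); [def |].
  intros x IH Hx; apply Hn; exists x; split; [exact Hx |].
  intros y Hy; destruct (rle_or_rlt x y) as [H | H]; [exact H |].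
  exfalso; exact (IH y H Hy).
Qed.

(** Only the larger of the two ranks counts. A recursion on pairs of names may therefore descend in
    both components and exchange them, as the two inclusions behind an equality do. *)
Lemma rlt_opair s t u v :
  rlt u s \/ rlt u t -> rlt v s \/ rlt v t -> rlt (opair u v) (opair s t).
Proof.
  intros Hu Hv.
  assert (Hm : exists m, m ∈ upair s t /\ rle s m /\ rle t m).
  { destruct (rle_or_rlt s t) as [H | H]; [exists t | exists s];
      rewrite in_upair; auto using rle_refl, rlt_rle. }
  destruct Hm as (m & Hm & Hs & Ht).
  assert (Hum : rlt u m) by (destruct Hu; eauto using rlt_rle_trans).
  assert (Hvm : rlt v m) by (destruct Hv; eauto using rlt_rle_trans).
  exists (upair s t); split; [apply in_upair; auto |].
  apply rle_unfold; intros a Ha; exists m; split; [exact Hm |].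
  apply rle_unfold; intros w Hw; apply in_upair in Ha.
  destruct Ha; subst a; apply in_upair in Hw; destruct Hw; subst w; assumption.
Qed.

Definition restrict (f y : V) : V :=
  setof (fun z => z ∈ f /\ exists u v, rlt u y /\ z = opair u v).

Lemma in_restrict z f y :
  z ∈ restrict f y <-> z ∈ f /\ exists u v, rlt u y /\ z = opair u v.
Proof. apply in_setof, (isset_sep _ f); [def | tauto]. Qed.

(** The sets of rank below [x] form a set, so approximations to a set-valued recursion are sets and
    the recursion is definable without class quantifiers. *)
Lemma rank_recursion (G : V -> V -> V) :
  definable (fun e => e 0 = G (e 1) (e 2)) ->
  exists F : V -> V, definable (fun e => e 0 = F (e 1)) /\
    forall x, exists f, F x = G x f /\
      forall y v, opair y v ∈ f <-> rlt y x /\ v = F y.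
Proof.
  intro HG.
  (* An approximation is defined on exactly the sets of rank below [x]; this fixed domain makes it
     unique. *)
  set (app := fun f x => forall z, z ∈ f <->
                exists y, rlt y x /\ z = opair y (G y (restrict f y))).
  assert (Happ : definable (fun e => app (e 0) (e 1))) by (unfold app, restrict; def).
  set (A := fun x => iota (fun f => app f x)).
  assert (HA : definable (fun e => e 0 = A (e 1))) by (unfold A; def).
  assert (Hres : forall f x y, app f x -> rlt y x -> app (restrict f y) y).
  { intros f x y Hf Hy z; rewrite in_restrict, (Hf z).
    assert (E : forall w, rlt w y -> restrict (restrict f y) w = restrict f w).
    { intros w Hw; apply setof_ext; intro z'; rewrite in_restrict; split; [tauto |].
      intros (H & u & v & Huw & ->); repeat split; try exact H;
        exists u, v; eauto using rlt_trans. }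
    split.
    - intros ((w & _ & ->) & u & v & Hu & E'); apply opair_inj in E'; destruct E'; subst u v.
      exists w; rewrite (E w Hu); auto.
    - intros (w & Hw & ->); rewrite (E w Hw); split.
      + exists w; eauto using rlt_trans.
      + eauto. }
  assert (Huniq : forall x f f', app f x -> app f' x -> f = f').
  { apply (rlt_ind (fun x => forall f f', app f x -> app f' x -> f = f')); [def |].
    intros x IH f f' Hf Hf'; apply set_ext; intro z; rewrite (Hf z), (Hf' z).
    split; intros (y & Hy & ->); exists y; split; trivial.
    - rewrite (IH y Hy _ _ (Hres f x y Hf Hy) (Hres f' x y Hf' Hy)); reflexivity.
    - rewrite (IH y Hy _ _ (Hres f x y Hf Hy) (Hres f' x y Hf' Hy)); reflexivity. }
  assert (Hex : forall x, exists f, app f x).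
  { apply (rlt_ind (fun x => exists f, app f x)); [def |].
    intros x IH.
    assert (HAx : forall y, rlt y x -> app (A y) y).
    { intros y Hy; apply (iota_spec (fun f => app f y)); [auto | apply Huniq]. }
    (* The approximations [A y] below [x] give the values [G y (A y)], which replacement glues into
       one graph. *)
    destruct (isset_rle x) as (r & Hr).
    destruct (isset_image (fun y z => rlt y x /\ z = opair y (G y (A y))) r) as (f & Hf).
    - def.
    - intros y z z' [_ ->] [_ ->]; reflexivity.
    - exists f; intro z; rewrite (Hf z).
      assert (E : forall y, rlt y x -> restrict f y = A y).
      { intros y Hy; apply set_ext; intro w; rewrite in_restrict, (Hf w).
        rewrite (HAx y Hy w).
        assert (E : forall u, rlt u y -> restrict (A y) u = A u).
        { intros u Hu; apply (Huniq u).
          - exact (Hres _ _ _ (HAx y Hy) Hu).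
          - apply HAx; exact (rlt_trans _ _ _ Hu Hy). }
        split.
        - intros ((u & _ & _ & ->) & u' & v & Hu & E'); apply opair_inj in E'.
          destruct E'; subst u' v; exists u; rewrite (E u Hu); auto.
        - intros (u & Hu & ->); rewrite (E u Hu); split; [| eauto].
          assert (rlt u x) by exact (rlt_trans _ _ _ Hu Hy).
          exists u; rewrite Hr; auto using rlt_rle. }
      split.
      + intros (y & _ & Hy & ->); exists y; rewrite (E y Hy); auto.
      + intros (y & Hy & ->); exists y; rewrite (E y Hy), Hr; auto using rlt_rle. }
  assert (HAs : forall x, app (A x) x).
  { intro x; apply (iota_spec (fun f => app f x)); [apply Hex | apply Huniq]. }
  exists (fun x => G x (A x)); split; [def |].
  intro x; exists (A x); split; [reflexivity |].
  intros y v; rewrite (HAs x (opair y v)).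
  assert (E : forall y, rlt y x -> restrict (A x) y = A y).
  { intros w Hw; apply (Huniq w); [exact (Hres _ _ _ (HAs x) Hw) | apply HAs]. }
  split.
  - intros (w & Hw & E'); apply opair_inj in E'; destruct E'; subst w v.
    rewrite (E y Hw); auto.
  - intros [Hy ->]; exists y; rewrite (E y Hy); auto.
Qed.

(** * Truth values *)

Section ForcingNotion.
Variables (P le : Class) (one : V).
Hypothesis HP : class_forcing P le one.
Local Notation "p ≤ q" := (rel le p q) (at level 70, no associativity).
Local Notation dense := (densely_below P le).

Lemma le_refl p : P p -> p ≤ p.
Proof. apply (cf_refl HP). Qed.

Lemma le_trans p q r : P p -> P q -> P r -> p ≤ q -> q ≤ r -> p ≤ r.
Proof. apply (cf_trans HP). Qed.

Lemma one_in : P one.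
Proof. exact (cf_top_in HP). Qed.

Lemma le_one p : P p -> p ≤ one.
Proof. apply (cf_top HP). Qed.

Definition regular (Q : V -> Prop) : Prop :=
  (forall p q, P p -> P q -> q ≤ p -> Q p -> Q q) /\
  (forall p, P p -> dense p Q -> Q p).

Lemma dense_now p (Q : V -> Prop) :
  P p -> (forall q, P q -> q ≤ p -> Q q) -> dense p Q.
Proof. intros Hp H p' Hp' Hle; exists p'; auto using le_refl. Qed.

Lemma dense_mono p (Q Q' : V -> Prop) :
  P p -> (forall q, P q -> q ≤ p -> Q q -> Q' q) -> dense p Q -> dense p Q'.
Proof.
  intros Hp H HQ p' Hp' Hle; destruct (HQ p' Hp' Hle) as (q & Hq & Hqp & HQq).
  exists q; eauto using le_trans.
Qed.

Lemma dense_down p q Q : P p -> P q -> q ≤ p -> dense p Q -> dense q Q.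
Proof. intros Hp Hq Hqp H p' Hp' Hle; apply H; eauto using le_trans. Qed.

Lemma dense_dense p Q : P p -> dense p (fun q => dense q Q) -> dense p Q.
Proof.
  intros Hp H p' Hp' Hle; destruct (H p' Hp' Hle) as (q & Hq & Hqp & HQ).
  destruct (HQ q Hq (le_refl q Hq)) as (r & Hr & Hrq & HQr).
  exists r; eauto using le_trans.
Qed.

(** Double complementation yields the interior of the closure, which a regular open class equals. *)
Lemma regular_not Q : regular Q -> forall p, P p ->
  (Q p <-> forall q, P q -> q ≤ p -> ~ forall r, P r -> r ≤ q -> ~ Q r).
Proof.
  intros [Hd Hr] p Hp; split.
  - intros HQ q Hq Hqp H; apply (H q Hq (le_refl q Hq)); exact (Hd p q Hp Hq Hqp HQ).
  - intro H; apply Hr; [exact Hp |]; intros q Hq Hqp.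
    apply NNPP; intro Hn; apply (H q Hq Hqp); intros r Hrr Hrq HQ; apply Hn; eauto.
Qed.

(** This is separativity: if [p] is not below [r], some extension of [p] is incompatible with [r],
    so the conditions below [r] are not dense below [p]. *)
Lemma below_regular r : P r -> regular (fun p => p ≤ r).
Proof.
  intro Hr; split; [intros; eauto using le_trans |].
  intros p Hp H; apply NNPP; intro Hn.
  destruct (cf_separative HP Hp Hr Hn) as (s & Hs & Hsp & Hc).
  destruct (H s Hs Hsp) as (q & Hq & Hqs & Hqr); apply Hc; exists q; auto.
Qed.

(* [T b] is the regular open class of conditions below the truth value [b]. *)
Record truth_values (B : V -> Prop) (T : V -> V -> Prop) : Prop := {
  tv_def_dom : definable (fun e => B (e 0));
  tv_def : definable (fun e => T (e 0) (e 1));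
  tv_regular : forall b, B b -> regular (T b);
  tv_compl : forall b, B b -> exists b', B b' /\
    forall p, P p -> (T b' p <-> forall q, P q -> q ≤ p -> ~ T b q);
  tv_inf : forall A : V, (forall a, a ∈ A -> B a) -> exists b, B b /\
    forall p, P p -> (T b p <-> forall a, a ∈ A -> T a p);
  tv_below : forall r, P r -> exists b, B b /\ forall p, P p -> (T b p <-> p ≤ r) }.

(** Uniqueness of the truth value with a given class makes [represents] a functional relation, as
    needed for replacement in [rep_all] and for [iota] in the recursions. *)
Definition extensional (B : V -> Prop) (T : V -> V -> Prop) : Prop :=
  forall b b', B b -> B b' -> (forall p, P p -> (T b p <-> T b' p)) -> b = b'.

(* Scott's trick: a truth value is replaced by the set of its equivalents of
   least rank. *)
Lemma extensional_truth_values B T :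
  truth_values B T -> exists B' T', truth_values B' T' /\ extensional B' T'.
Proof.
  intro H; pose proof (tv_def_dom _ _ H) as DB; pose proof (tv_def _ _ H) as DT.
  set (eqv := fun k k' => B k' /\ forall p, P p -> (T k p <-> T k' p)).
  set (cutp := fun k k' => eqv k k' /\ forall k'', eqv k k'' -> rle k' k'').
  set (cut := fun k => setof (cutp k)).
  assert (Deqv : definable (fun e => eqv (e 0) (e 1))) by (unfold eqv; def).
  assert (Dcutp : definable (fun e => cutp (e 0) (e 1))) by (unfold cutp; def).
  assert (Dcut : definable (fun e => e 0 = cut (e 1))) by (unfold cut; def).
  assert (Hrefl : forall k, B k -> eqv k k) by (unfold eqv; intuition).
  assert (in_cut : forall k, B k -> forall k', k' ∈ cut k <-> cutp k k').
  { intros k Hk; apply in_setof.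
    destruct (isset_rle k) as (r & Hr); apply (isset_sep _ r); [def |].
    intros k' [_ Hmin]; apply Hr, Hmin, Hrefl, Hk. }
  assert (cut_ne : forall k, B k -> exists k', k' ∈ cut k).
  { intros k Hk; destruct (rank_minimal (eqv k)) as (k' & Hk' & Hmin); [def | eauto |].
    exists k'; apply in_cut; [exact Hk | split; assumption]. }
  set (B' := fun b => exists k, B k /\ b = cut k).
  (* The members of an element of [B'] are equivalent, so any one of them decides. *)
  set (T' := fun b p => exists k, k ∈ b /\ T k p).
  assert (T'_cut : forall k p, B k -> P p -> (T' (cut k) p <-> T k p)).
  { intros k p Hk Hp; split.
    - intros (k' & Hk' & HT); apply in_cut in Hk'; [| exact Hk].
      apply Hk'; assumption.
    - intro HT; destruct (cut_ne k Hk) as (k' & Hk'); exists k'.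
      split; [exact Hk' |]; apply in_cut in Hk'; [| exact Hk].
      apply Hk'; assumption. }
  exists B', T'; split; [split |].
  - unfold B'; def.
  - unfold T'; def.
  - intros b (k & Hk & ->); destruct (tv_regular _ _ H k Hk) as [Hd Hr]; split.
    + intros p q Hp Hq Hqp; rewrite !T'_cut; eauto.
    + intros p Hp HD; apply T'_cut; trivial; apply Hr; [exact Hp |].
      revert HD; apply dense_mono; [exact Hp |]; intros q Hq _; apply T'_cut; trivial.
  - intros b (k & Hk & ->); destruct (tv_compl _ _ H k Hk) as (k' & Hk' & E).
    exists (cut k'); split; [exists k'; auto |].
    intros p Hp; rewrite T'_cut, (E p Hp) by trivial.
    split; intros HN q Hq Hqp HT; apply (HN q Hq Hqp), (T'_cut k); trivial.
  - intros A HA.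
    (* Taking all representatives at once avoids choosing one from each element of [A]; equivalent
       ones do not change the infimum. *)
    destruct (tv_inf _ _ H (union A)) as (k & Hk & E).
    + intros k Hk; apply in_union in Hk; destruct Hk as (b & Hb & Hk).
      destruct (HA b Hb) as (k' & Hk' & ->); apply in_cut in Hk; [| exact Hk'].
      apply Hk.
    + exists (cut k); split; [exists k; auto |].
      intros p Hp; rewrite T'_cut, (E p Hp) by trivial; split.
      * intros HT b Hb; destruct (HA b Hb) as (k' & Hk' & ->).
        destruct (cut_ne k' Hk') as (k'' & Hk''); exists k''; split; [exact Hk'' |].
        apply HT, in_union; eauto.
      * intros HT k' Hk'; apply in_union in Hk'; destruct Hk' as (b & Hb & Hk').
        specialize (HT b Hb); destruct (HA b Hb) as (k'' & Hk'' & ->).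
        apply T'_cut in HT; trivial; apply in_cut in Hk'; [| exact Hk''].
        apply Hk'; assumption.
  - intros r Hr; destruct (tv_below _ _ H r Hr) as (k & Hk & E).
    exists (cut k); split; [exists k; auto |].
    intros p Hp; rewrite T'_cut by trivial; apply E, Hp.
  - intros b b' (k & Hk & ->) (k' & Hk' & ->) HT.
    assert (HE : forall p, P p -> (T k p <-> T k' p)).
    { intros p Hp; specialize (HT p Hp); rewrite !T'_cut in HT; trivial. }
    assert (HEE : forall x, eqv k x <-> eqv k' x).
    { intro x; unfold eqv; split; intros [Hx HTx]; split; trivial; intros p Hp;
        specialize (HTx p Hp); specialize (HE p Hp); tauto. }
    apply setof_ext; intro x; unfold cutp; rewrite HEE.
    split; intros [Hx Hmin]; (split; [exact Hx |]); intros y Hy; apply Hmin, HEE, Hy.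
Qed.

Lemma truth_values_bottom B T :
  truth_values B T -> exists b, B b /\ forall p, P p -> ~ T b p.
Proof.
  intro H; destruct (tv_below _ _ H one (cf_top_in HP)) as (b & Hb & E).
  destruct (tv_compl _ _ H b Hb) as (b' & Hb' & E'); exists b'; split; [exact Hb' |].
  intros p Hp HT; revert HT; rewrite (E' p Hp); intro HT.
  apply (HT p Hp (le_refl p Hp)), E; [exact Hp | apply (cf_top HP), Hp].
Qed.

Section Extensional.
Variables (B : V -> Prop) (T : V -> V -> Prop).
Hypothesis HT : truth_values B T.
Hypothesis HE : extensional B T.

Let DB : definable (fun e => B (e 0)) := tv_def_dom _ _ HT.
Let DT : definable (fun e => T (e 0) (e 1)) := tv_def _ _ HT.

Definition represents (Q : V -> Prop) (b : V) : Prop :=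
  B b /\ forall p, P p -> (T b p <-> Q p).

Definition rep (Q : V -> Prop) : Prop := exists b, represents Q b.

Lemma represents_unique Q b b' : represents Q b -> represents Q b' -> b = b'.
Proof.
  intros [Hb E] [Hb' E']; apply HE; trivial.
  intros p Hp; rewrite (E p Hp), (E' p Hp); reflexivity.
Qed.

Lemma rep_ext (Q Q' : V -> Prop) :
  (forall p, P p -> (Q p <-> Q' p)) -> rep Q -> rep Q'.
Proof.
  intros H (b & Hb & E); exists b; split; [exact Hb |].
  intros p Hp; rewrite (E p Hp); apply H, Hp.
Qed.

Lemma rep_value b : B b -> rep (T b).
Proof. intro Hb; exists b; split; [exact Hb | reflexivity]. Qed.

Lemma rep_not Q : rep Q -> rep (fun p => forall q, P q -> q ≤ p -> ~ Q q).
Proof.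
  intros (b & Hb & E); destruct (tv_compl _ _ HT b Hb) as (b' & Hb' & E').
  exists b'; split; [exact Hb' |]; intros p Hp; rewrite (E' p Hp).
  split; intros H q Hq Hqp HQ; apply (H q Hq Hqp), (E q Hq), HQ.
Qed.

Lemma rep_below r : P r -> rep (fun p => p ≤ r).
Proof. apply (tv_below _ _ HT). Qed.

Lemma rep_and Q Q' : rep Q -> rep Q' -> rep (fun p => Q p /\ Q' p).
Proof.
  intros (b & Hb & E) (b' & Hb' & E').
  destruct (tv_inf _ _ HT (upair b b')) as (c & Hc & Ec).
  - intros a Ha; apply in_upair in Ha; destruct Ha; subst; assumption.
  - exists c; split; [exact Hc |]; intros p Hp.
    rewrite (Ec p Hp), <- (E p Hp), <- (E' p Hp); split.
    + intro H; split; apply H, in_upair; auto.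
    + intros [] a Ha; apply in_upair in Ha; destruct Ha; subst; assumption.
Qed.

(** Replacement collects the unique values of the [Q x] into a set, whose infimum is the value
    wanted. *)
Lemma rep_all (Q : V -> V -> Prop) a :
  definable (fun e => Q (e 0) (e 1)) -> (forall x, x ∈ a -> rep (Q x)) ->
  rep (fun p => forall x, x ∈ a -> Q x p).
Proof.
  intros HQ H.
  destruct (isset_image (fun x b => represents (Q x) b) a) as (s & Hs).
  - unfold represents; def.
  - intros x b b'; apply represents_unique.
  - destruct (tv_inf _ _ HT s) as (c & Hc & Ec).
    + intros b Hb; apply Hs in Hb; destruct Hb as (x & _ & Hb); apply Hb.
    + exists c; split; [exact Hc |]; intros p Hp; rewrite (Ec p Hp); split.
      * intros Hall x Hx; destruct (H x Hx) as (b & Hb).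
        apply Hb; [exact Hp |]; apply Hall, Hs; exists x; auto.
      * intros Hall b Hb; apply Hs in Hb; destruct Hb as (x & Hx & Hb).
        apply Hb; auto.
Qed.

Lemma rep_ex (Q : V -> V -> Prop) a :
  definable (fun e => Q (e 0) (e 1)) -> (forall x, x ∈ a -> rep (Q x)) ->
  rep (fun p => dense p (fun q => exists x, x ∈ a /\ Q x q)).
Proof.
  intros HQ H.
  apply (rep_ext (fun p => forall q, P q -> q ≤ p ->
           ~ forall x, x ∈ a -> forall r, P r -> r ≤ q -> ~ Q x r)).
  - intros p Hp; split.
    + intros Hn q Hq Hqp; specialize (Hn q Hq Hqp); apply NNPP; intro Hno.
      apply Hn; intros x Hx r Hr Hrq HQx; apply Hno; exists r; eauto.
    + intros Hd q Hq Hqp Hn; destruct (Hd q Hq Hqp) as (r & Hr & Hrq & x & Hx & HQx).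
      exact (Hn x Hx r Hr Hrq HQx).
  - apply rep_not, (rep_all (fun x p => forall r, P r -> r ≤ p -> ~ Q x r)); [def |].
    intros x Hx; apply rep_not, H, Hx.
Qed.

(** The shape of clause (c) for inclusion, at one element of the left-hand name. It is the negation
    of being below [r] while forcing [Q] to fail. *)
Lemma rep_dense_imp r Q :
  P r -> rep Q ->
  rep (fun p => forall q, P q -> q ≤ p -> q ≤ r -> exists q', P q' /\ q' ≤ q /\ Q q').
Proof.
  intros Hr HQ.
  apply (rep_ext (fun p => forall q, P q -> q ≤ p ->
           ~ (q ≤ r /\ forall q', P q' -> q' ≤ q -> ~ Q q'))).
  - intros p Hp; split.
    + intros H q Hq Hqp Hqr; apply NNPP; intro Hn; apply (H q Hq Hqp).
      split; [exact Hqr |]; intros q' Hq' Hle HQ'; apply Hn; eauto.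
    + intros H q Hq Hqp [Hqr Hn]; destruct (H q Hq Hqp Hqr) as (q' & Hq' & Hle & HQ').
      exact (Hn q' Hq' Hle HQ').
  - apply rep_not, rep_and; [apply rep_below, Hr | apply rep_not, HQ].
Qed.

Lemma rep_false : rep (fun _ => False).
Proof.
  destruct (truth_values_bottom _ _ HT) as (b & Hb & E).
  exists b; split; [exact Hb |]; intros p Hp; specialize (E p Hp); tauto.
Qed.

Lemma rep_true : rep (fun _ => True).
Proof.
  apply (rep_ext (fun p => forall q, P q -> q ≤ p -> ~ False)); [tauto |].
  exact (rep_not _ rep_false).
Qed.

(** * From truth values to a Boolean completion *)

Lemma truth_values_completion : admits_boolean_completion P le.
Proof.
  destruct (class_of B DB) as (CB & HCB).
  destruct (class_of (fun z => exists a b, z = opair a b /\ B a /\ B b /\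
              forall p, P p -> T a p -> T b p)) as (L & HL0); [def |].
  assert (HL : forall a b, rel L a b <-> B a /\ B b /\ forall p, P p -> T a p -> T b p).
  { intros a b; rewrite rel_eq, HL0; split.
    - intros (a' & b' & E & H); apply opair_inj in E; destruct E; subst; exact H.
    - intro H; exists a, b; auto. }
  clear HL0.
  destruct rep_false as (zero & Hz & Ez), rep_true as (unit & Hu & Eu).
  (* Distributivity is stated for arbitrary meets and joins, so any element that is a meet or join
     in the order has to be identified with the computed class. The same holds for [join_T]. *)
  assert (meet_T : forall a b m, B a -> B b -> is_meet CB L a b m ->
            represents (fun p => T a p /\ T b p) m).
  { intros a b m Ha Hb (Hm & Hlow & Hgr); apply HCB in Hm; split; [exact Hm |].
    destruct (rep_and _ _ (rep_value a Ha) (rep_value b Hb)) as (c & Hc & Ec).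
    assert (Hcm : rel L c m).
    { apply Hgr; [apply HCB, Hc |]; intros x [-> | ->]; apply HL;
        (split; [exact Hc | split; [assumption |]]); intros p Hp Hcp;
        apply (Ec p Hp) in Hcp; tauto. }
    assert (Hma : rel L m a) by (apply Hlow; auto).
    assert (Hmb : rel L m b) by (apply Hlow; auto).
    apply HL in Hcm, Hma, Hmb.
    intros p Hp; rewrite <- (Ec p Hp); split.
    - intro H; apply Ec; [exact Hp |]; split; [apply Hma | apply Hmb]; trivial.
    - apply Hcm, Hp. }
  (* A union of regular open classes need not be regular; density below [p] regularizes it. *)
  assert (rep_join : forall a b, B a -> B b -> rep (fun p => dense p (fun q => T a q \/ T b q))).
  { intros a b Ha Hb.
    apply (rep_ext (fun p => dense p (fun q => exists x, x ∈ upair a b /\ T x q))).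
    - intros p Hp; split; apply dense_mono; trivial; intros q _ _.
      + intros (x & Hx & H); apply in_upair in Hx; destruct Hx; subst; auto.
      + intros [H | H]; [exists a | exists b]; rewrite in_upair; auto.
    - apply rep_ex; [def |]; intros x Hx; apply in_upair in Hx; apply rep_value.
      destruct Hx; subst; assumption. }
  assert (join_T : forall a b s, B a -> B b -> is_join CB L a b s ->
            represents (fun p => dense p (fun q => T a q \/ T b q)) s).
  { intros a b s Ha Hb (Hs & Hup & Hleast); apply HCB in Hs; split; [exact Hs |].
    destruct (rep_join a b Ha Hb) as (c & Hc & Ec).
    assert (Hsc : rel L s c).
    { apply Hleast; [apply HCB, Hc |]; intros x Hx; apply HL.
      assert (Bx : B x) by (destruct Hx; subst; assumption).
      do 2 (split; [assumption |]); intros p Hp Hxp; apply (Ec p Hp).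
      apply dense_now; [exact Hp |]; intros q Hq Hqp.
      assert (T x q) by (apply (tv_regular _ _ HT x Bx) with p; trivial).
      destruct Hx; subst; auto. }
    assert (Has : rel L a s) by (apply Hup; auto).
    assert (Hbs : rel L b s) by (apply Hup; auto).
    apply HL in Hsc, Has, Hbs.
    intros p Hp; split.
    - intro H; apply (Ec p Hp), Hsc; trivial.
    - intro H; apply (tv_regular _ _ HT s Hs); [exact Hp |]; revert H.
      apply dense_mono; [exact Hp |]; intros q Hq _ [H | H];
        [apply Has | apply Hbs]; trivial. }
  assert (sup_of : forall (A : V -> Prop) s, (forall a, A a -> B a) ->
            represents (fun p => dense p (fun q => exists a, A a /\ T a q)) s ->
            is_sup CB L A s).
  { intros A s HA [Hs Es]; split; [apply HCB, Hs |]; split.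
    - intros a Ha; apply HL; split; [apply HA, Ha | split; [exact Hs |]].
      intros p Hp Hap; apply (Es p Hp), dense_now; [exact Hp |]; intros q Hq Hqp.
      exists a; split; [exact Ha |]; apply (tv_regular _ _ HT a (HA a Ha)) with p; trivial.
    - intros b Hb Hub; apply HCB in Hb; apply HL; split; [exact Hs | split; [exact Hb |]].
      intros p Hp Hsp; apply (tv_regular _ _ HT b Hb); [exact Hp |].
      apply (Es p Hp) in Hsp; revert Hsp; apply dense_mono; [exact Hp |].
      intros q Hq _ (a & Ha & Haq); specialize (Hub a Ha); apply HL in Hub.
      apply Hub; trivial. }
  assert (inf_of : forall (A : V -> Prop) s, (forall a, A a -> B a) ->
            represents (fun p => forall a, A a -> T a p) s -> is_inf CB L A s).
  { intros A s HA [Hs Es]; split; [apply HCB, Hs |]; split.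
    - intros a Ha; apply HL; split; [exact Hs | split; [apply HA, Ha |]].
      intros p Hp Hsp; exact (proj1 (Es p Hp) Hsp a Ha).
    - intros b Hb Hlb; apply HCB in Hb; apply HL; split; [exact Hb | split; [exact Hs |]].
      intros p Hp Hbp; apply (Es p Hp); intros a Ha; specialize (Hlb a Ha).
      apply HL in Hlb; apply Hlb; trivial. }
  assert (is_meet_of : forall a b m, B a -> B b ->
            represents (fun p => T a p /\ T b p) m -> is_meet CB L a b m).
  { intros a b m Ha Hb [Hm Em]; apply inf_of; [intros x [-> | ->]; trivial |].
    split; [exact Hm |]; intros p Hp; rewrite (Em p Hp); split.
    - intros [] x [-> | ->]; trivial.
    - auto. }
  assert (is_join_of : forall a b s, B a -> B b ->
            represents (fun p => dense p (fun q => T a q \/ T b q)) s -> is_join CB L a b s).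
  { intros a b m Ha Hb [Hm Em]; apply sup_of; [intros x [-> | ->]; trivial |].
    split; [exact Hm |]; intros p Hp; rewrite (Em p Hp); split;
      apply dense_mono; trivial; intros q _ _.
    - intros [H | H]; eauto.
    - intros (x & [-> | ->] & H); auto. }
  exists CB, L, zero, unit; split; [split | split].
  - intros a Ha; apply HCB in Ha; apply HL; auto.
  - intros a b Ha Hb Hab Hba; apply HL in Hab, Hba; apply HE; try apply Hab.
    intros p Hp; split; [apply Hab | apply Hba]; exact Hp.
  - intros a b c _ _ _ Hab Hbc; apply HL in Hab, Hbc; apply HL; intuition.
  - intros a b Ha Hb; apply HCB in Ha, Hb.
    destruct (rep_join a b Ha Hb) as (s & Hs); exists s; auto.
  - intros a b Ha Hb; apply HCB in Ha, Hb.
    destruct (rep_and _ _ (rep_value a Ha) (rep_value b Hb)) as (s & Hs); exists s; auto.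
  - apply HCB, Hz.
  - intros a Ha; apply HCB in Ha; apply HL; do 2 (split; [assumption |]).
    intros p Hp H; apply (Ez p Hp) in H; destruct H.
  - apply HCB, Hu.
  - intros a Ha; apply HCB in Ha; apply HL; do 2 (split; [assumption |]).
    intros p Hp _; apply (Eu p Hp), I.
  - intros a b c bc ab ac l r Ha Hb Hc Hbc Hl Hab Hac Hr; apply HCB in Ha, Hb, Hc.
    apply join_T in Hbc; trivial; apply meet_T in Hl; [| exact Ha | apply Hbc].
    apply meet_T in Hab, Hac; trivial; apply join_T in Hr; [| apply Hab | apply Hac].
    apply HE; [apply Hl | apply Hr |]; intros p Hp.
    rewrite (proj2 Hl p Hp), (proj2 Hr p Hp), (proj2 Hbc p Hp); split.
    + intros [Hap HD]; revert HD; apply dense_mono; [exact Hp |].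
      intros q Hq Hqp HD; rewrite (proj2 Hab q Hq), (proj2 Hac q Hq).
      assert (T a q) by (apply (tv_regular _ _ HT a Ha) with p; trivial); tauto.
    + intro HD; split.
      * apply (tv_regular _ _ HT a Ha); [exact Hp |]; revert HD.
        apply dense_mono; [exact Hp |]; intros q Hq _.
        rewrite (proj2 Hab q Hq), (proj2 Hac q Hq); tauto.
      * revert HD; apply dense_mono; [exact Hp |]; intros q Hq _.
        rewrite (proj2 Hab q Hq), (proj2 Hac q Hq); tauto.
  - intros a Ha; apply HCB in Ha; destruct (rep_not _ (rep_value a Ha)) as (a' & Ha' & E).
    exists a'; split; [apply HCB, Ha' |]; split.
    + apply is_meet_of; trivial; split; [exact Hz |]; intros p Hp.
      rewrite (Ez p Hp), (E p Hp); split; [tauto |].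
      intros [H H']; exact (H' p Hp (le_refl p Hp) H).
    + apply is_join_of; trivial; split; [exact Hu |]; intros p Hp.
      rewrite (Eu p Hp); split; [intros _ | trivial]; intros q Hq Hqp.
      destruct (classic (exists r, P r /\ r ≤ q /\ T a r)) as [(r & Hr & Hrq & H) | H].
      * exists r; auto.
      * exists q; split; [exact Hq | split; [apply le_refl, Hq | right]].
        apply (E q Hq); intros r Hr Hrq Har; apply H; eauto.
  - intros A HA.
    assert (HA' : forall a, a ∈ A -> B a) by (intros a Ha; apply HCB, HA, Ha).
    split.
    + destruct (rep_ex T A DT) as (s & Hs); [intros; apply rep_value; auto |].
      exists s; apply sup_of; auto.
    + destruct (rep_all T A DT) as (s & Hs); [intros; apply rep_value; auto |].
      exists s; apply inf_of; auto.
  (* The embedding sends a condition to the truth value of its cone. *)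
  - destruct (class_of (fun z => exists p b, z = opair p b /\ P p /\
                represents (fun q => q ≤ p) b)) as (i & Hi0); [unfold represents; def |].
    assert (Hi : forall p b, rel i p b <-> P p /\ represents (fun q => q ≤ p) b).
    { intros p b; rewrite rel_eq, Hi0; split.
      - intros (p' & b' & E & H); apply opair_inj in E; destruct E; subst; exact H.
      - intro H; exists p, b; auto. }
    exists i; split; [| split; [| split]].
    + intros p Hp; destruct (rep_below p Hp) as (b & Hb); exists b; split; [split |].
      * apply HCB, Hb.
      * intros ->; apply (Ez p Hp), (proj2 Hb p Hp), le_refl, Hp.
      * intro b'; rewrite Hi; split.
        -- intros [_ Hb']; exact (represents_unique _ _ _ Hb' Hb).
        -- intros ->; auto.
    + intros p q a b Hp Hq Ha Hb Hpq; apply Hi in Ha, Hb.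
      destruct Ha as [_ [Ha Ea]], Hb as [_ [Hb Eb]]; apply HL.
      do 2 (split; [assumption |]); intros r Hr Har.
      apply (Eb r Hr); apply (Ea r Hr) in Har; eauto using le_trans.
    + intros p q a b Hp Hq Ha Hb Hn (c & [Hc Hcz] & Hca & Hcb); apply Hi in Ha, Hb.
      destruct Ha as [_ [Ha Ea]], Hb as [_ [Hb Eb]]; apply HL in Hca, Hcb.
      apply HCB in Hc; apply Hcz, HE; trivial; intros r Hr; rewrite (Ez r Hr).
      split; [| tauto]; intro HTr; apply Hn; exists r; split; [exact Hr |].
      split; [apply (Ea r Hr), Hca | apply (Eb r Hr), Hcb]; trivial.
    (* A nonzero [b] has some condition [p] in [T b], and the cone of [p] is then included in
       [T b]. *)
    + intros b [Hb Hbz]; apply HCB in Hb; apply NNPP; intro Hn; apply Hbz, HE; trivial.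
      intros p Hp; rewrite (Ez p Hp); split; [| tauto]; intro Hbp; apply Hn.
      destruct (rep_below p Hp) as (a & Ha); exists p, a; split; [exact Hp |].
      split; [apply Hi; auto |]; apply HL; split; [apply Ha | split; [exact Hb |]].
      intros q Hq Haq; apply (proj2 Ha q Hq) in Haq.
      apply (tv_regular _ _ HT b Hb) with p; trivial.
Qed.

End Extensional.

(** * From a Boolean completion to truth values *)

Section BooleanAlgebra.
Variables (B leB : Class) (zero unit : V).
Hypothesis HB : class_boolean_algebra B leB zero unit.

(** By distributivity [a] is the join of its meets with [b] and with [b'], and the second meet is
    zero. *)
Lemma disjoint_complement_le b b' a :
  B b -> B b' -> is_join B leB b b' unit -> B a ->
  (forall x, B x -> rel leB x a -> rel leB x b' -> x = zero) -> rel leB a b.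
Proof.
  intros Hb Hb' Hj Ha Hz.
  destruct (cba_meet HB Ha Hb) as (m & Hm), (cba_meet HB Ha Hb') as (m' & Hm').
  assert (Em : m' = zero).
  { destruct Hm' as (Hm'B & Hlow & _); apply Hz; [exact Hm'B | |]; apply Hlow; auto. }
  subst m'.
  assert (Hau : is_meet B leB a unit a).
  { split; [exact Ha |]; split.
    - intros x [-> | ->]; [apply (cba_refl HB) | apply (cba_unit HB)]; exact Ha.
    - intros x Hx H; apply H; auto. }
  assert (Hmz : is_join B leB m zero m).
  { destruct Hm as (HmB & _); split; [exact HmB |]; split.
    - intros x [-> | ->]; [apply (cba_refl HB) | apply (cba_zero HB)]; exact HmB.
    - intros x Hx H; apply H; auto. }
  rewrite (cba_distr HB Ha Hb Hb' Hj Hau Hm Hm' Hmz).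
  destruct Hm as (_ & Hlow & _); apply Hlow; auto.
Qed.

End BooleanAlgebra.

Lemma completion_truth_values :
  admits_boolean_completion P le ->
  exists B T, truth_values B T /\ extensional B T.
Proof.
  intros (B & leB & zero & unit & HB & Hcomp & i & Hi & Himono & Hiinc & Hidense).
  assert (Hifun : forall p a a', P p -> rel i p a -> rel i p a' -> a = a').
  { intros p a a' Hp Ha Ha'; destruct (Hi p Hp) as (b & _ & E).
    apply E in Ha, Ha'; congruence. }
  assert (HiB : forall p a, P p -> rel i p a -> B a /\ a <> zero).
  { intros p a Hp Ha; destruct (Hi p Hp) as (b & Hb & E).
    apply E in Ha; subst; exact Hb. }
  assert (Hiex : forall p, P p -> exists a, rel i p a).
  { intros p Hp; destruct (Hi p Hp) as (b & _ & E); exists b; apply E; reflexivity. }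
  assert (Hbot : forall x, B x -> rel leB x zero -> x = zero).
  { intros x Hx H; apply (cba_antisym HB); trivial; [apply (cba_zero_in HB) |].
    apply (cba_zero HB); exact Hx. }
  (* Density gives [p'] with image below [x], hence below the image of [p]. Since incompatibility is
     preserved, [p'] and [p] have a common extension. *)
  assert (Hcommon : forall p a b x, P p -> rel i p a -> B b -> B x -> x <> zero ->
            rel leB x a -> rel leB x b ->
            exists q c, P q /\ q ≤ p /\ rel i q c /\ rel leB c b).
  { intros p a b x Hp Ha Hb Hx Hxz Hxa Hxb.
    destruct (Hidense x) as (p' & c & Hp' & Hc & Hcx); [split; assumption |].
    destruct (HiB p a Hp Ha) as [HaB _], (HiB p' c Hp' Hc) as [HcB Hcz].
    destruct (classic (compatible P (rel le) p' p)) as [(q & Hq & Hqp' & Hqp) | Hn].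
    - destruct (Hiex q Hq) as (d & Hd); exists q, d; do 3 (split; [assumption |]).
      destruct (HiB q d Hq Hd) as [HdB _].
      apply (cba_trans HB) with c; trivial; [| apply (cba_trans HB) with x; trivial].
      exact (Himono q p' d c Hq Hp' Hd Hc Hqp').
    - exfalso; apply (Hiinc p' p c a Hp' Hp Hc Ha Hn).
      exists c; split; [split; assumption |]; split; [apply (cba_refl HB), HcB |].
      apply (cba_trans HB) with x; trivial. }
  set (T := fun b p => exists a, rel i p a /\ rel leB a b).
  assert (Tdown : forall b p q, B b -> P p -> P q -> q ≤ p -> T b p -> T b q).
  { intros b p q Hb Hp Hq Hqp (a & Ha & Hab).
    destruct (Hiex q Hq) as (c & Hc); exists c; split; [exact Hc |].
    apply (cba_trans HB) with a; trivial; [apply (HiB q c) | apply (HiB p a) |]; trivial.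
    exact (Himono q p c a Hq Hp Hc Ha Hqp). }
  assert (Tnot : forall b b' p, B b -> B b' -> is_meet B leB b b' zero ->
            P p -> T b p -> T b' p -> False).
  { intros b b' p Hb Hb' (_ & _ & Hgr) Hp (a & Ha & Hab) (a' & Ha' & Hab').
    rewrite (Hifun p a' a Hp Ha' Ha) in Hab'.
    destruct (HiB p a Hp Ha) as [HaB Haz]; apply Haz, Hbot; [exact HaB |].
    apply Hgr; [exact HaB |]; intros x [-> | ->]; assumption. }
  (* If no extension of [p] had its image below the complement [b'], the image of [p] would be
     disjoint from [b'] and therefore below [b]. *)
  assert (Twit : forall b b' p, B b -> B b' -> is_join B leB b b' unit -> P p ->
            ~ T b p -> exists q, P q /\ q ≤ p /\ T b' q).
  { intros b b' p Hb Hb' Hj Hp Hn; destruct (Hiex p Hp) as (a & Ha).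
    destruct (HiB p a Hp Ha) as [HaB _]; apply NNPP; intro Hno.
    apply Hn; exists a; split; [exact Ha |].
    apply (disjoint_complement_le _ _ _ _ HB b b'); trivial.
    intros x Hx Hxa Hxb'; apply NNPP; intro Hxz; apply Hno.
    destruct (Hcommon p a b' x) as (q & c & Hq & Hqp & Hc & Hcb); trivial.
    exists q; split; [exact Hq | split; [exact Hqp |]]; exists c; auto. }
  assert (Hsymj : forall b b', is_join B leB b b' unit -> is_join B leB b' b unit).
  { intros b b' (H1 & H2 & H3); split; [exact H1 | split].
    - intros x Hx; apply H2; tauto.
    - intros x Hx H; apply H3; [exact Hx |]; intros y Hy; apply H; tauto. }
  exists B, T; split; [split |].
  - def.
  - unfold T; def.
  - intros b Hb; split; [eauto |]; intros p Hp HD; apply NNPP; intro Hn.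
    destruct (cba_compl HB Hb) as (b' & Hb' & Hm & Hj).
    destruct (Twit b b' p Hb Hb' Hj Hp Hn) as (q & Hq & Hqp & Hq').
    destruct (HD q Hq Hqp) as (r & Hr & Hrq & HTr).
    apply (Tnot b b' r); eauto.
  - intros b Hb; destruct (cba_compl HB Hb) as (b' & Hb' & Hm & Hj).
    exists b'; split; [exact Hb' |]; intros p Hp; split.
    + intros HT q Hq Hqp HTq; apply (Tnot b b' q); eauto.
    + intros H; apply NNPP; intro Hn.
      destruct (Twit b' b p Hb' Hb (Hsymj _ _ Hj) Hp Hn) as (q & Hq & Hqp & Hq').
      exact (H q Hq Hqp Hq').
  - intros A HA; destruct (Hcomp A HA) as (_ & s & Hs & Hlow & Hgr).
    exists s; split; [exact Hs |]; intros p Hp; split.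
    + intros (a & Ha & Has) x Hx; exists a; split; [exact Ha |].
      destruct (HiB p a Hp Ha) as [HaB _].
      apply (cba_trans HB) with s; auto.
    + intro H; destruct (Hiex p Hp) as (a & Ha); exists a; split; [exact Ha |].
      apply Hgr; [apply (HiB p a); trivial |]; intros x Hx.
      destruct (H x Hx) as (a' & Ha' & Hle); rewrite (Hifun p a a'); trivial.
  - intros r Hr; destruct (Hiex r Hr) as (b & Hb); destruct (HiB r b Hr Hb) as [HbB _].
    exists b; split; [exact HbB |]; intros p Hp; split.
    (* Otherwise separativity yields [s] below [p] incompatible with [r], although the image of [s]
       lies below that of [r]. *)
    + intros (a & Ha & Hab); apply NNPP; intro Hn.
      destruct (cf_separative HP Hp Hr Hn) as (s & Hs & Hsp & Hc).
      destruct (Hiex s Hs) as (c & Hcs); destruct (HiB s c Hs Hcs) as [HcB Hcz].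
      apply (Hiinc s r c b Hs Hr Hcs Hb Hc); exists c; split; [split; trivial |].
      split; [apply (cba_refl HB), HcB |].
      apply (cba_trans HB) with a; trivial; [apply (HiB p a); trivial |].
      exact (Himono s p c a Hs Hp Hcs Ha Hsp).
    + intro Hpr; destruct (Hiex p Hp) as (a & Ha); exists a; split; [exact Ha |].
      exact (Himono p r a b Hp Hr Ha Hb Hpr).
  - assert (Hle : forall b b', B b -> B b' -> (forall p, P p -> T b p -> T b' p) -> rel leB b b').
    { intros b b' Hb Hb' H; destruct (cba_compl HB Hb') as (c & Hc & Hm & Hj).
      apply (disjoint_complement_le _ _ _ _ HB b' c); trivial.
      intros x Hx Hxb Hxc; apply NNPP; intro Hxz.
      destruct (Hidense x) as (p & a & Hp & Ha & Hax); [split; assumption |].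
      destruct (HiB p a Hp Ha) as [HaB _].
      apply (Tnot b' c p); trivial; [apply H; trivial |]; exists a;
        (split; [exact Ha | apply (cba_trans HB) with x; trivial]). }
    intros b b' Hb Hb' H; apply (cba_antisym HB); trivial; apply Hle; trivial;
      intros p Hp; apply (H p Hp).
Qed.

(** * Definability of codes, names and check names *)

Lemma def_num n t : dterm t -> definable (fun e => is_num n (t e)).
Proof.
  apply def1; induction n as [|n IH]; simpl.
  - unfold is_empty; def.
  - unfold is_succ; def.
Qed.

Lemma def_tagged n t u :
  dterm t -> dterm u -> definable (fun e => tagged n (t e) (u e)).
Proof.
  apply def2; apply def_ex, def_and; [apply def_num |]; def.
Qed.

Lemma def_eq_code t u v :
  dterm t -> dterm u -> dterm v -> definable (fun e => eq_code (t e) (u e) (v e)).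
Proof.
  apply def3; apply def_ex, def_and; [| apply def_tagged]; def.
Qed.

Lemma def_in_code t u v :
  dterm t -> dterm u -> dterm v -> definable (fun e => in_code (t e) (u e) (v e)).
Proof.
  apply def3; apply def_ex, def_and; [| apply def_tagged]; def.
Qed.

Lemma def_name t : dterm t -> definable (fun e => is_name P (t e)).
Proof. apply def1; unfold is_name; def. Qed.

Lemma def_check t u : dterm t -> dterm u -> definable (fun e => is_check one (t e) (u e)).
Proof. apply def2; unfold is_check; def. Qed.

Ltac def_forcing ::=
  lazymatch goal with
  | |- definable (fun e => tagged ?n (@?t e) (@?u e)) => refine (def_tagged n t u _ _)
  | |- definable (fun e => eq_code (@?t e) (@?u e) (@?v e)) =>
      refine (def_eq_code t u v _ _ _)
  | |- definable (fun e => in_code (@?t e) (@?u e) (@?v e)) =>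
      refine (def_in_code t u v _ _ _)
  | |- definable (fun e => is_name _ (@?t e)) => refine (def_name t _)
  | |- definable (fun e => is_check _ (@?t e) (@?u e)) => refine (def_check t u _ _)
  end.

Lemma uniform_atomic :
  admits_uniform_forcing_relation P le one -> admits_atomic_forcing_relation P le.
Proof.
  intros (F & Fsub & HF).
  assert (H : forall Q : V -> V -> V -> Prop, definable (fun e => Q (e 0) (e 1) (e 2)) ->
            exists X : Class, rel3 X = (fun p s t => exists c, Q c s t /\ rel F p c)).
  { intros Q HQ.
    destruct (class_of (fun z => exists p s t c, z = opair p (opair s t) /\
                Q c s t /\ rel F p c)) as (X & HX); [def |].
    exists X; do 3 (apply functional_extensionality; intro).
    apply propositional_extensionality; rewrite rel3_eq, HX; split.
    - intros (p & s & t & c & E & H); apply opair_inj in E; destruct E as [-> E].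
      apply opair_inj in E; destruct E as [-> ->]; exists c; exact H.
    - intros (c & H); do 3 eexists; exists c; split; [reflexivity | exact H]. }
  destruct (H in_code) as (Fin & HFin); [def |].
  destruct (H eq_code) as (Feq & HFeq); [def |].
  exists Fin, Fsub, Feq; rewrite HFin, HFeq; apply (uf_atomic HF).
Qed.

(** * Truth values from an atomic forcing relation *)

Lemma name_elem s y :
  is_name P s -> y ∈ s -> exists t p, y = opair t p /\ is_name P t /\ P p.
Proof.
  intros (N & Hs & HN) Hy; destruct (HN s y Hs Hy) as (t & p & E & Ht & Hp).
  apply is_opair_eq in E; exists t, p; split; [exact E | split; [exists N; auto | exact Hp]].
Qed.

Lemma name_pair s t p : is_name P s -> opair t p ∈ s -> is_name P t /\ P p.
Proof.
  intros Hs H; destruct (name_elem s _ Hs H) as (t' & p' & E & HH).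
  apply opair_inj in E; destruct E; subst; exact HH.
Qed.

(** The witnessing set consists of the names in a transitive superset, with [s] itself adjoined. *)
Lemma name_intro s :
  (forall y, y ∈ s -> exists t p, y = opair t p /\ is_name P t /\ P p) -> is_name P s.
Proof.
  intro H; destruct (transitive_superset (upair s s)) as (N & HsN & Htr).
  destruct (isset_sep (fun x => x ∈ N /\ (is_name P x \/ x = s)) N) as (N' & HN');
    [def | tauto |].
  assert (HsN' : s ∈ N) by (apply HsN, in_upair; auto).
  exists N'; split; [apply HN'; auto |].
  intros x y Hx Hy; apply HN' in Hx; destruct Hx as [HxN Hx].
  assert (Hyy : exists t p, y = opair t p /\ is_name P t /\ P p).
  { destruct Hx as [Hx | ->]; [exact (name_elem x y Hx Hy) | exact (H y Hy)]. }
  destruct Hyy as (t & p & -> & Ht & Hp); exists t, p.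
  split; [apply is_opair_eq; reflexivity | split; [| exact Hp]].
  apply HN'; split; [| auto].
  apply (Htr (upair t t)); [| apply in_upair; auto].
  apply (Htr (opair t p)); [exact (Htr _ _ HxN Hy) | apply in_upair; auto].
Qed.

Lemma rlt_fst s u r : opair u r ∈ s -> rlt u s.
Proof.
  intro H; apply (rlt_trans _ (upair u u)); [apply rlt_mem, in_upair; auto |].
  apply (rlt_trans _ (opair u r)); apply rlt_mem; [apply in_upair; auto | exact H].
Qed.

Lemma name_ind (Q : V -> Prop) :
  definable (fun e => Q (e 0)) ->
  (forall s, is_name P s -> (forall u r, opair u r ∈ s -> Q u) -> Q s) ->
  forall s, is_name P s -> Q s.
Proof.
  intros HQ Hstep; apply (rlt_ind (fun s => is_name P s -> Q s)); [def |].
  intros s IH Hs; apply Hstep; [exact Hs |]; intros u r Hu.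
  apply IH; [exact (rlt_fst _ _ _ Hu) | exact (proj1 (name_pair _ _ _ Hs Hu))].
Qed.

(* the name of the set of the values of the names in [S] *)
Definition full_name (S : V) : V := setof (fun z => exists x, x ∈ S /\ z = opair x one).

Lemma in_full_name S z : z ∈ full_name S <-> exists x, x ∈ S /\ z = opair x one.
Proof. apply in_setof, (isset_fun_image (fun x => opair x one)); def. Qed.

Lemma is_name_full_name S : (forall x, x ∈ S -> is_name P x) -> is_name P (full_name S).
Proof.
  intro H; apply name_intro; intros y Hy; apply in_full_name in Hy.
  destruct Hy as (x & Hx & ->); exists x, one; auto using one_in.
Qed.

(** * Equality and membership for a given atomic forcing relation *)

Section Atomic.
Variables FinC FsubC FeqC : Class.
Local Notation Fin := (rel3 FinC).
Local Notation Fsub := (rel3 FsubC).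
Local Notation Feq := (rel3 FeqC).
Hypothesis HF : is_atomic_forcing P le Fin Fsub Feq.
Local Notation name := (is_name P).

Lemma forces_in p s t : P p -> name s -> name t ->
  (Fin p s t <-> dense p (fun q => exists u r, opair u r ∈ t /\ q ≤ r /\ Feq q s u)).
Proof.
  intros Hp Hs Ht; rewrite (af_in HF Hp Hs Ht).
  split; apply dense_mono; trivial; intros q _ _ (u & r & H & Hq);
    exists u, r; apply setrel_eq in H || apply setrel_eq; auto.
Qed.

Lemma forces_sub p s t : P p -> name s -> name t ->
  (Fsub p s t <-> forall u r, opair u r ∈ s ->
     forall q', P q' -> q' ≤ p -> q' ≤ r -> exists q, P q /\ q ≤ q' /\ Fin q u t).
Proof.
  intros Hp Hs Ht; rewrite (af_sub HF Hp Hs Ht).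
  split; intros H u r; [intros Hur q'; apply H, setrel_eq, Hur |].
  intros q' Hur; apply H, setrel_eq, Hur.
Qed.

Lemma forces_eq p s t : P p -> name s -> name t ->
  (Feq p s t <-> Fsub p s t /\ Fsub p t s).
Proof. apply (af_eq HF). Qed.

Lemma forces_in_dense p s t : P p -> name s -> name t ->
  dense p (fun q => Fin q s t) -> Fin p s t.
Proof.
  intros Hp Hs Ht H; apply forces_in; trivial; apply dense_dense; [exact Hp |].
  revert H; apply dense_mono; [exact Hp |]; intros q Hq _; apply forces_in; trivial.
Qed.

Lemma forces_sub_regular s t : name s -> name t -> regular (fun p => Fsub p s t).
Proof.
  intros Hs Ht; split.
  - intros p q Hp Hq Hqp H; rewrite forces_sub in *; trivial.
    intros u r Hur q' Hq' Hq'q; apply (H u r Hur); eauto using le_trans.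
  - intros p Hp H; apply forces_sub; trivial; intros u r Hur q Hq Hqp Hqr.
    destruct (H q Hq Hqp) as (q' & Hq' & Hq'q & Hsub).
    rewrite forces_sub in Hsub by trivial.
    destruct (name_pair _ _ _ Hs Hur) as [Hu Hr].
    destruct (Hsub u r Hur q' Hq') as (q'' & Hq'' & Hle & HH); eauto using le_refl, le_trans.
Qed.

Lemma forces_eq_regular s t : name s -> name t -> regular (fun p => Feq p s t).
Proof.
  intros Hs Ht.
  destruct (forces_sub_regular s t Hs Ht) as [Hd Hr].
  destruct (forces_sub_regular t s Ht Hs) as [Hd' Hr'].
  split.
  - intros p q Hp Hq Hqp; rewrite !forces_eq by trivial; intros []; eauto.
  - intros p Hp H; apply forces_eq; trivial; split; [apply Hr | apply Hr']; trivial;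
      revert H; apply dense_mono; trivial; intros q Hq _ H;
      apply forces_eq in H; trivial; apply H.
Qed.

Lemma forces_eq_refl s p : name s -> P p -> Feq p s s.
Proof.
  intro Hs; revert p; revert s Hs.
  apply (name_ind (fun s => forall p, P p -> Feq p s s)); [def |].
  intros s Hs IH p Hp.
  assert (Fsub p s s); [| apply forces_eq; auto].
  apply forces_sub; trivial; intros u r Hur q Hq Hqp Hqr.
  destruct (name_pair _ _ _ Hs Hur) as [Hu Hr].
  exists q; split; [exact Hq | split; [apply le_refl, Hq |]].
  apply forces_in; trivial; apply dense_now; trivial; intros q' Hq' Hle.
  exists u, r; repeat split; eauto using le_trans.
Qed.

Lemma forces_eq_sym s t p : name s -> name t -> P p -> Feq p s t -> Feq p t s.
Proof. intros Hs Ht Hp; rewrite !forces_eq by trivial; tauto. Qed.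

Lemma forces_eq_trans s t v p : name s -> name t -> name v -> P p ->
  Feq p s t -> Feq p t v -> Feq p s v.
Proof.
  intro Hs; revert t v p; revert s Hs.
  apply (name_ind (fun s => forall t v p, name t -> name v -> P p ->
    Feq p s t -> Feq p t v -> Feq p s v)); [def |].
  intros s Hs IH t v p Ht Hv Hp Hst Htv.
  (* A member of one side is matched, below a stronger condition, with a member of the other. *)
  assert (Hstep : forall a b q u r, name a -> name b -> P q -> q ≤ p -> Feq p a b ->
            opair u r ∈ a -> q ≤ r ->
            exists q' u' r', P q' /\ q' ≤ q /\ opair u' r' ∈ b /\ q' ≤ r' /\ Feq q' u u').
  { intros a b q u r Ha Hb Hq Hqp Hab Hu Hqr.
    destruct (name_pair _ _ _ Ha Hu) as [Hun _].
    apply forces_eq in Hab; trivial; destruct Hab as [Hab _].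
    rewrite forces_sub in Hab by trivial.
    destruct (Hab u r Hu q Hq Hqp Hqr) as (q1 & Hq1 & Hle & Hin).
    apply forces_in in Hin; trivial.
    destruct (Hin q1 Hq1 (le_refl q1 Hq1)) as (q2 & Hq2 & Hle2 & u' & r' & H1 & H2 & H3).
    exists q2, u', r'; split; [exact Hq2 |]; split; [apply (le_trans q2 q1 q) |]; auto. }
  assert (Hint : forall q u w, P q -> name u -> name w ->
            (exists u' r', opair u' r' ∈ w /\ q ≤ r' /\ Feq q u u') -> Fin q u w).
  { intros q u w Hq Hu Hw (u' & r' & H1 & H2 & H3); apply forces_in; trivial.
    destruct (name_pair _ _ _ Hw H1) as [Hu' Hr'].
    apply dense_now; trivial; intros q' Hq' Hle; exists u', r'.
    repeat split; eauto using le_trans; apply (forces_eq_regular u u' Hu Hu') with q; trivial. }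
  apply forces_eq; trivial; split; apply forces_sub; trivial; intros u r Hur q Hq Hqp Hqr.
  - destruct (Hstep s t q u r) as (q1 & u1 & r1 & Hq1 & Hle1 & Hu1 & Hqr1 & E1); trivial.
    destruct (name_pair _ _ _ Hs Hur) as [Hu _], (name_pair _ _ _ Ht Hu1) as [Hu1n Hr1].
    assert (q1 ≤ p) by eauto using le_trans.
    destruct (Hstep t v q1 u1 r1) as (q2 & u2 & r2 & Hq2 & Hle2 & Hu2 & Hqr2 & E2); trivial.
    destruct (name_pair _ _ _ Hv Hu2) as [Hu2n Hr2].
    exists q2; split; [exact Hq2 | split; [apply (le_trans q2 q1 q); trivial |]].
    apply Hint; trivial; exists u2, r2; split; [exact Hu2 | split; [exact Hqr2 |]].
    apply (IH u r Hur u1 u2 q2); trivial.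
    apply (forces_eq_regular u u1 Hu Hu1n) with q1; trivial.
  - apply forces_eq_sym in Hst, Htv; trivial.
    destruct (Hstep v t q u r) as (q1 & u1 & r1 & Hq1 & Hle1 & Hu1 & Hqr1 & E1); trivial.
    destruct (name_pair _ _ _ Hv Hur) as [Hu _], (name_pair _ _ _ Ht Hu1) as [Hu1n Hr1].
    assert (q1 ≤ p) by eauto using le_trans.
    destruct (Hstep t s q1 u1 r1) as (q2 & u2 & r2 & Hq2 & Hle2 & Hu2 & Hqr2 & E2); trivial.
    destruct (name_pair _ _ _ Hs Hu2) as [Hu2n Hr2].
    exists q2; split; [exact Hq2 | split; [apply (le_trans q2 q1 q); trivial |]].
    apply Hint; trivial; exists u2, r2; split; [exact Hu2 | split; [exact Hqr2 |]].
    (* The induction hypothesis concerns members of [s], so the chain is read backwards, from [u2]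
       in [s] through [u1] in [t] to [u] in [v]. *)
    apply forces_eq_sym; trivial; apply (IH u2 r2 Hu2 u1 u q2); trivial.
    + apply forces_eq_sym; trivial.
    + apply forces_eq_sym; trivial.
      apply (forces_eq_regular u u1 Hu Hu1n) with q1; trivial.
Qed.

Definition names (S : V) : Prop := forall x, x ∈ S -> name x.

Lemma forces_in_full p x S : P p -> name x -> names S ->
  (Fin p x (full_name S) <-> dense p (fun q => exists y, y ∈ S /\ Feq q x y)).
Proof.
  intros Hp Hx HS; rewrite forces_in; trivial; [| apply is_name_full_name, HS].
  split; apply dense_mono; trivial; intros q Hq _.
  - intros (u & r & Hu & _ & H); apply in_full_name in Hu; destruct Hu as (y & Hy & E).
    apply opair_inj in E; destruct E; subst; eauto.
  - intros (y & Hy & H); exists y, one; split; [apply in_full_name; eauto |].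
    split; [apply le_one, Hq | exact H].
Qed.

Lemma forces_in_full_intro p x y S : P p -> names S -> name x -> y ∈ S ->
  Feq p x y -> Fin p x (full_name S).
Proof.
  intros Hp HS Hx Hy H; apply forces_in_full; trivial; apply dense_now; trivial.
  intros q Hq Hqp; exists y; split; [exact Hy |].
  apply (forces_eq_regular x y Hx (HS y Hy)) with p; trivial.
Qed.

Lemma forces_sub_full p S S' : P p -> names S -> names S' ->
  (Fsub p (full_name S) (full_name S') <-> forall x, x ∈ S -> Fin p x (full_name S')).
Proof.
  intros Hp HS HS'; pose proof (is_name_full_name S HS) as HSn.
  pose proof (is_name_full_name S' HS') as HSn'.
  rewrite forces_sub by trivial; split.
  - intros H x Hx; apply forces_in_dense; auto; intros q Hq Hqp.
    apply (H x one); trivial; [apply in_full_name; eauto | apply le_one, Hq].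
  - intros H u r Hu q Hq Hqp _; apply in_full_name in Hu; destruct Hu as (x & Hx & E).
    apply opair_inj in E; destruct E; subst.
    exists q; split; [exact Hq | split; [apply le_refl, Hq |]].
    specialize (H x Hx); rewrite forces_in in *; auto; eapply dense_down; [exact Hp | | |];
      eassumption.
Qed.

Lemma forces_eq_full p S S' : P p -> names S -> names S' ->
  (Feq p (full_name S) (full_name S') <->
   (forall x, x ∈ S -> Fin p x (full_name S')) /\
   (forall x, x ∈ S' -> Fin p x (full_name S))).
Proof.
  intros Hp HS HS'.
  rewrite forces_eq, !forces_sub_full by auto using is_name_full_name; reflexivity.
Qed.

Definition pair_name (a b : V) : V := full_name (upair a b).

Lemma names_upair a b : name a -> name b -> names (upair a b).
Proof. intros Ha Hb x Hx; apply in_upair in Hx; destruct Hx; subst; assumption. Qed.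

Lemma is_name_pair a b : name a -> name b -> name (pair_name a b).
Proof. intros; apply is_name_full_name, names_upair; assumption. Qed.

Lemma forces_pair_singleton p a b c : P p -> name a -> name b -> name c ->
  (Feq p (pair_name a b) (pair_name c c) <-> Feq p a c /\ Feq p b c).
Proof.
  intros Hp Ha Hb Hc; unfold pair_name.
  rewrite forces_eq_full by auto using names_upair.
  assert (Hin : forall x, name x -> Fin p x (full_name (upair c c)) -> Feq p x c).
  { intros x Hx H; apply forces_in_full in H; auto using names_upair.
    apply (forces_eq_regular x c Hx Hc); [exact Hp |]; revert H.
    apply dense_mono; trivial; intros q Hq _ (y & Hy & H).
    apply in_upair in Hy; destruct Hy; subst; exact H. }
  split.
  - intros [H _]; split; apply Hin; trivial; apply H, in_upair; auto.
  - intros [H H']; split; intros x Hx; apply in_upair in Hx.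
    + apply (forces_in_full_intro p x c); auto using names_upair; [| apply in_upair; auto |];
        destruct Hx; subst; trivial.
    + apply (forces_in_full_intro p x a); auto using names_upair;
        [| apply in_upair; auto |]; destruct Hx; subst; auto using forces_eq_sym.
Qed.

(** * Set-sized conjunctions and disjunctions of equations *)

Section Equations.
(* a set of pairs of names, seen as equations *)
Variable E : V.
Hypothesis HE : forall a b, opair a b ∈ E -> name a /\ name b.

Lemma isset_equations (g : V -> V -> V) :
  definable (fun e => e 0 = g (e 1) (e 2)) ->
  isset (fun z => exists a b, opair a b ∈ E /\ z = g a b).
Proof.
  intro Hg.
  destruct (isset_image (fun x z => exists a b, x = opair a b /\ z = g a b) E) as (s & Hs).
  - def.
  - intros x z z' (a & b & -> & ->) (a' & b' & H & ->).
    apply opair_inj in H; destruct H; subst; reflexivity.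
  - exists s; intro z; rewrite Hs; split.
    + intros (x & Hx & a & b & -> & ->); eauto.
    + intros (a & b & H & ->); eauto 6.
Qed.

(** A set of singletons can test all equations at once. If [{a,b}] equals the singleton [{c}] coming
    from a different equation, then [a] and [b] both equal [c], so they still equal each other. *)
Lemma left_sides : exists U,
  (forall z, z ∈ U <-> exists a b, opair a b ∈ E /\ z = pair_name a a) /\
  names U /\
  forall p a b, P p -> opair a b ∈ E -> (Fin p (pair_name a b) (full_name U) <-> Feq p a b).
Proof.
  destruct (isset_equations (fun a b => pair_name a a)) as (U & HU).
  { unfold pair_name, full_name; def. }
  exists U; split; [exact HU |].
  assert (HUn : names U).
  { intros x Hx; apply HU in Hx; destruct Hx as (a & b & H & ->).
    destruct (HE a b H); apply is_name_pair; assumption. }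
  split; [exact HUn |]; intros p a b Hp Hab; destruct (HE a b Hab) as [Ha Hb].
  split.
  - intro H; apply forces_in_full in H; auto using is_name_pair.
    apply (forces_eq_regular a b Ha Hb); trivial; revert H; apply dense_mono; trivial.
    intros q Hq _ (y & Hy & H); apply HU in Hy; destruct Hy as (c & d & Hc & ->).
    destruct (HE c d Hc) as [Hcn _].
    apply forces_pair_singleton in H; trivial; destruct H as [H1 H2].
    apply forces_eq_trans with c; auto using forces_eq_sym.
  - intro H; apply forces_in_full_intro with (pair_name a a); auto using is_name_pair.
    + apply HU; eauto.
    + apply forces_pair_singleton; auto using forces_eq_refl, forces_eq_sym.
Qed.

(** The inclusion of [W] in [U] is written as the equation of [U ∪ W] with [U]. *)
Lemma conjunction_equation : exists A B, name A /\ name B /\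
  forall p, P p -> (Feq p A B <-> forall a b, opair a b ∈ E -> Feq p a b).
Proof.
  destruct left_sides as (U & HU & HUn & Hkey).
  destruct (isset_equations pair_name) as (W & HW); [unfold pair_name, full_name; def |].
  assert (Hcn : names (cup U W)).
  { intros x Hx; apply in_cup in Hx; destruct Hx as [Hx | Hx]; [exact (HUn x Hx) |].
    apply HW in Hx; destruct Hx as (a & b & H & ->).
    destruct (HE a b H); apply is_name_pair; assumption. }
  exists (full_name (cup U W)), (full_name U).
  do 2 (split; [apply is_name_full_name; assumption |]).
  intros p Hp; rewrite forces_eq_full by trivial; split.
  - intros [H _] a b Hab; apply Hkey; trivial; apply H, in_cup; right; apply HW; eauto.
  - intro H; split; intros x Hx.
    + apply in_cup in Hx; destruct Hx as [Hx | Hx].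
      * apply forces_in_full_intro with x; auto using forces_eq_refl.
      * apply HW in Hx; destruct Hx as (a & b & Hab & ->); apply Hkey; auto.
    + apply forces_in_full_intro with x; auto using forces_eq_refl.
      apply in_cup; auto.
Qed.

(** [U] equals [U ∪ {{a,b}}] exactly if [{a,b}] is in [U], that is, if [a = b]. Membership of [U] in
    the set [Z] of these extensions is the disjunction, and it becomes the equation of [Z ∪ {U}]
    with [Z]. *)
Lemma disjunction_equation : exists A B, name A /\ name B /\
  forall p, P p ->
    (Feq p A B <-> dense p (fun q => exists a b, opair a b ∈ E /\ Feq q a b)).
Proof.
  destruct left_sides as (U & HU & HUn & Hkey).
  set (add := fun a b => cup U (upair (pair_name a b) (pair_name a b))).
  destruct (isset_equations (fun a b => full_name (add a b))) as (Z & HZ).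
  { unfold add, pair_name, full_name, cup; def. }
  assert (Hadd : forall a b, opair a b ∈ E -> names (add a b)).
  { intros a b Hab x Hx; apply in_cup in Hx; destruct Hx as [Hx | Hx]; [exact (HUn x Hx) |].
    destruct (HE a b Hab); apply in_upair in Hx; destruct Hx; subst;
      apply is_name_pair; assumption. }
  assert (HZn : names Z).
  { intros x Hx; apply HZ in Hx; destruct Hx as (a & b & H & ->).
    apply is_name_full_name, Hadd, H. }
  set (N := full_name U).
  assert (HN : name N) by apply is_name_full_name, HUn.
  assert (Hcn : names (cup Z (upair N N))).
  { intros x Hx; apply in_cup in Hx; destruct Hx as [Hx | Hx]; [exact (HZn x Hx) |].
    apply in_upair in Hx; destruct Hx; subst; exact HN. }
  assert (HNadd : forall p a b, P p -> opair a b ∈ E ->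
            (Feq p N (full_name (add a b)) <-> Feq p a b)).
  { intros p a b Hp Hab; rewrite <- (Hkey p a b Hp Hab).
    unfold N; rewrite forces_eq_full by auto; split.
    - intros [_ H]; apply H, in_cup; right; apply in_upair; auto.
    - intro H; split; intros x Hx.
      + apply forces_in_full_intro with x; auto using forces_eq_refl.
        apply in_cup; auto.
      + apply in_cup in Hx; destruct Hx as [Hx | Hx].
        * apply forces_in_full_intro with x; auto using forces_eq_refl.
        * apply in_upair in Hx; destruct Hx; subst; exact H. }
  exists (full_name (cup Z (upair N N))), (full_name Z).
  do 2 (split; [apply is_name_full_name; assumption |]).
  intros p Hp; rewrite forces_eq_full by trivial.
  transitivity (Fin p N (full_name Z)).
  - split.
    + intros [H _]; apply H, in_cup; right; apply in_upair; auto.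
    + intro H; split; intros x Hx.
      * apply in_cup in Hx; destruct Hx as [Hx | Hx].
        -- apply forces_in_full_intro with x; auto using forces_eq_refl.
        -- apply in_upair in Hx; destruct Hx; subst; exact H.
      * apply forces_in_full_intro with x; auto using forces_eq_refl.
        apply in_cup; auto.
  - rewrite forces_in_full by trivial; split; apply dense_mono; trivial; intros q Hq _.
    + intros (y & Hy & H); apply HZ in Hy; destruct Hy as (a & b & Hab & ->).
      exists a, b; split; [exact Hab |]; apply HNadd; trivial.
    + intros (a & b & Hab & H); exists (full_name (add a b)); split; [apply HZ; eauto |].
      apply HNadd; trivial.
Qed.

End Equations.

Lemma is_name_empty : name empty.
Proof. apply name_intro; intros y Hy; destruct (in_empty _ Hy). Qed.

(** The name [g] evaluates to [{∅}] if [r] is in the generic filter and to [∅] otherwise, so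
    comparing it with these two sets expresses that [r] is in the filter and that it is not. *)
Lemma below_equations r : P r -> exists A B C D, (name A /\ name B /\ name C /\ name D) /\
  forall p, P p -> (Feq p A B <-> p ≤ r) /\ (Feq p C D <-> forall q, P q -> q ≤ p -> ~ q ≤ r).
Proof.
  intro Hr; pose proof is_name_empty as H0.
  set (g := upair (opair empty r) (opair empty r)).
  assert (Hg : forall z, z ∈ g <-> z = opair empty r).
  { intro z; unfold g; rewrite in_upair; tauto. }
  assert (Hgn : name g) by (apply name_intro; intros y Hy; apply Hg in Hy; eauto).
  assert (HS : names (upair empty empty)) by (apply names_upair; exact H0).
  set (o := full_name (upair empty empty)).
  assert (Hon : name o) by (apply is_name_full_name, HS).
  exists g, o, g, empty; split; [auto |]; intros p Hp; split.
  - rewrite forces_eq, !forces_sub by trivial; split.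
    + intros [_ H]; apply (below_regular r Hr); [exact Hp |]; intros q Hq Hqp.
      destruct (H empty one) with (q' := q) as (q' & Hq' & Hle & Hin); trivial.
      * apply in_full_name; exists empty; rewrite in_upair; auto.
      * apply le_one, Hq.
      * apply forces_in in Hin; trivial.
        destruct (Hin q' Hq' (le_refl q' Hq')) as (q'' & Hq'' & Hle' & u & s & Hu & Hs & _).
        apply Hg, opair_inj in Hu; destruct Hu; subst; exists q''; eauto using le_trans.
    + intro Hpr; split; intros u s Hu q Hq Hqp Hqs; exists q; (split; [exact Hq |]);
        (split; [apply le_refl, Hq |]).
      * apply Hg, opair_inj in Hu; destruct Hu; subst.
        apply forces_in_full_intro with empty; trivial; [apply in_upair; auto |].
        apply forces_eq_refl; trivial.
      * apply in_full_name in Hu; destruct Hu as (x & Hx & E); apply opair_inj in E.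
        destruct E; subst; assert (x = empty) by (apply in_upair in Hx; tauto); subst x.
        apply forces_in; trivial; apply dense_now; trivial; intros q' Hq' Hle.
        exists empty, r; split; [apply Hg; reflexivity |].
        assert (q' ≤ p) by eauto using le_trans.
        split; [eauto using le_trans | apply forces_eq_refl; trivial].
  - rewrite forces_eq, !forces_sub by trivial; split.
    + intros [H _] q Hq Hqp Hqr.
      destruct (H empty r) with (q' := q) as (q' & Hq' & _ & Hin); trivial.
      * apply Hg; reflexivity.
      * apply forces_in in Hin; trivial.
        destruct (Hin q' Hq' (le_refl q' Hq')) as (_ & _ & _ & u & s & Hu & _).
        destruct (in_empty _ Hu).
    + intro H; split; intros u s Hu q Hq Hqp Hqs.
      * exfalso; apply Hg, opair_inj in Hu; destruct Hu; subst; exact (H q Hq Hqp Hqs).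
      * destruct (in_empty _ Hu).
Qed.

(* A truth value is coded by an equation between names together with an equation
   that is forced exactly when the first one is forced to fail. *)
Definition code (A B C D : V) : Prop :=
  (name A /\ name B /\ name C /\ name D) /\
  forall p, P p ->
    (Feq p A B <-> forall q, P q -> q ≤ p -> ~ Feq q C D) /\
    (Feq p C D <-> forall q, P q -> q ≤ p -> ~ Feq q A B).

(** The other half of [code] follows because the class of conditions forcing [A = B] is regular,
    hence its own double complement. *)
Lemma code_intro A B C D : name A -> name B -> name C -> name D ->
  (forall p, P p -> (Feq p C D <-> forall q, P q -> q ≤ p -> ~ Feq q A B)) ->
  code A B C D.
Proof.
  intros HA HB HC HD H; split; [auto |]; intros p Hp; split; [| apply H, Hp].
  rewrite (regular_not _ (forces_eq_regular A B HA HB) p Hp).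
  split; intros HH q Hq Hqp; specialize (HH q Hq Hqp); [rewrite (H q Hq) | rewrite (H q Hq) in HH];
    exact HH.
Qed.

Lemma atomic_truth_values : exists B T, truth_values B T.
Proof.
  set (K := fun k => exists A B C D, k = opair (opair A B) (opair C D) /\ code A B C D).
  set (T := fun k p => exists A B y, k = opair (opair A B) y /\ Feq p A B).
  assert (HT : forall A B y p, T (opair (opair A B) y) p <-> Feq p A B).
  { intros A B y p; split; [| unfold T; eauto].
    intros (A' & B' & y' & E & H); apply opair_inj in E; destruct E as [E _].
    apply opair_inj in E; destruct E; subst; exact H. }
  exists K, T; split.
  - unfold K, code; def.
  - unfold T; def.
  - intros k (A & B & C & D & -> & ((HA & HB & _) & _)).
    destruct (forces_eq_regular A B HA HB) as [Hd Hr]; split.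
    + intros p q Hp Hq Hqp; rewrite !HT; eauto.
    + intros p Hp H; apply HT, Hr; [exact Hp |]; revert H.
      apply dense_mono; trivial; intros q Hq _; apply HT.
  - intros k (A & B & C & D & -> & (HN & H)); exists (opair (opair C D) (opair A B)); split.
    + exists C, D, A, B; split; [reflexivity |]; split; [tauto |].
      intros p Hp; specialize (H p Hp); tauto.
    + intros p Hp; rewrite HT, (proj2 (H p Hp)).
      split; intros HH q Hq Hqp; specialize (HH q Hq Hqp); rewrite HT in *; exact HH.
  - intros S HS.
    (* [E1] and [E2] are the two projections of [S]: the equations and the equations for their
       complements. *)
    destruct (isset_image (fun k x => exists y, k = opair x y) S) as (E1 & HE1).
    { def. }
    { intros k x x' (y & ->) (y' & E); apply opair_inj in E; tauto. }
    destruct (isset_image (fun k y => exists x, k = opair x y) S) as (E2 & HE2).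
    { def. }
    { intros k y y' (x & ->) (x' & E); apply opair_inj in E; tauto. }
    assert (HE1' : forall a b, opair a b ∈ E1 <-> exists c d, opair (opair a b) (opair c d) ∈ S).
    { intros a b; rewrite HE1; split.
      - intros (k & Hk & y & ->); destruct (HS _ Hk) as (A & B & C & D & E & _).
        apply opair_inj in E; destruct E; subst; eauto.
      - intros (c & d & H); eauto. }
    assert (HE2' : forall c d, opair c d ∈ E2 <-> exists a b, opair (opair a b) (opair c d) ∈ S).
    { intros c d; rewrite HE2; split.
      - intros (k & Hk & y & ->); destruct (HS _ Hk) as (A & B & C & D & E & _).
        apply opair_inj in E; destruct E; subst; eauto.
      - intros (a & b & H); eauto. }
    assert (HS' : forall a b c d, opair (opair a b) (opair c d) ∈ S -> code a b c d).
    { intros a b c d H; destruct (HS _ H) as (A & B & C & D & E & HC).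
      apply opair_inj in E; destruct E as [E E'].
      apply opair_inj in E, E'; destruct E, E'; subst; exact HC. }
    clear HE1 HE2.
    destruct (conjunction_equation E1) as (A & B & HA & HB & HAB).
    { intros a b H; apply HE1' in H; destruct H as (c & d & H); apply HS' in H.
      destruct H as [H _]; tauto. }
    (* By De Morgan, the disjunction of the complements is the complement of the conjunction over
       [E1]. *)
    destruct (disjunction_equation E2) as (C & D & HC & HD & HCD).
    { intros c d H; apply HE2' in H; destruct H as (a & b & H); apply HS' in H.
      destruct H as [H _]; tauto. }
    exists (opair (opair A B) (opair C D)); split.
    + exists A, B, C, D; split; [reflexivity |]; apply code_intro; trivial.
      intros p Hp; rewrite (HCD p Hp); split.
      * intros H q Hq Hqp HF'; destruct (H q Hq Hqp) as (r & Hr & Hrq & c & d & Hcd & HFr).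
        apply HE2' in Hcd; destruct Hcd as (a & b & Hk).
        assert (HFq : Feq q a b) by (apply (HAB q Hq); [exact HF' | apply HE1'; eauto]).
        destruct (HS' _ _ _ _ Hk) as [_ Hcode].
        exact (proj1 (proj1 (Hcode q Hq)) HFq r Hr Hrq HFr).
      * intros H q Hq Hqp; apply NNPP; intro Hn; apply (H q Hq Hqp), (HAB q Hq).
        intros a b Hab; apply HE1' in Hab; destruct Hab as (c & d & Hk).
        destruct (HS' _ _ _ _ Hk) as [_ Hcode]; apply (proj1 (Hcode q Hq)).
        intros r Hr Hrq HFr; apply Hn; exists r; do 2 (split; [assumption |]).
        exists c, d; split; [apply HE2'; eauto | exact HFr].
    + intros p Hp; rewrite HT, (HAB p Hp); split.
      * intros H k Hk; destruct (HS k Hk) as (a & b & c & d & -> & _).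
        apply HT, H, HE1'; eauto.
      * intros H a b Hab; apply HE1' in Hab; destruct Hab as (c & d & Hk).
        specialize (H _ Hk); apply HT in H; exact H.
  - intros r Hr; destruct (below_equations r Hr) as (A & B & C & D & (HA & HB & HC & HD) & H).
    exists (opair (opair A B) (opair C D)); split.
    + exists A, B, C, D; split; [reflexivity |]; apply code_intro; trivial.
      intros p Hp; rewrite (proj2 (H p Hp)).
      split; intros HH q Hq Hqp; specialize (HH q Hq Hqp);
        rewrite (proj1 (H q Hq)) in *; exact HH.
    + intros p Hp; rewrite HT; apply (H p Hp).
Qed.

End Atomic.

(** * Evaluation of sentences *)

Lemma num_exists n : exists z : V, is_num n z.
Proof.
  induction n as [|n [y Hy]]; simpl; [exact empty_exists |].
  exists (succ y), y; split; [exact Hy | apply succ_eq; reflexivity].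
Qed.

Lemma num_inj m n (z : V) : is_num m z -> is_num n z -> m = n.
Proof.
  revert n z; induction m as [|m IH]; intros [|n] z; simpl; trivial.
  - rewrite empty_eq; intros -> (y & _ & H); apply succ_eq in H.
    destruct (succ_nonempty y); auto.
  - rewrite empty_eq; intros (y & _ & H) ->; apply succ_eq in H.
    destruct (succ_nonempty y); auto.
  - intros (y & Hy & E) (y' & Hy' & E'); apply succ_eq in E, E'; subst z.
    apply succ_inj in E'; subst y'; f_equal; exact (IH n y Hy Hy').
Qed.

Lemma tagged_unique n (c x x' : V) : tagged n c x -> tagged n c x' -> x = x'.
Proof.
  intros (k & _ & H) (k' & _ & H'); apply is_opair_eq in H, H'; subst.
  apply opair_inj in H'; tauto.
Qed.

Lemma tagged_tag m n (c x y : V) : tagged m c x -> tagged n c y -> m = n.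
Proof.
  intros (k & Hk & H) (k' & Hk' & H'); apply is_opair_eq in H, H'; subst.
  apply opair_inj in H'; destruct H'; subst; exact (num_inj m n _ Hk Hk').
Qed.

Lemma tagged_exists n (x : V) : exists c, tagged n c x.
Proof.
  destruct (num_exists n) as (k & Hk); exists (opair k x), k.
  split; [exact Hk | apply is_opair_eq; reflexivity].
Qed.

Lemma rlt_tagged n (c x : V) : tagged n c x -> rlt x c.
Proof.
  intros (k & _ & H); apply is_opair_eq in H; subst.
  apply (rlt_trans _ (upair k x)); apply rlt_mem, in_upair; auto.
Qed.

Lemma pair_code_unique n (c s t s' t' : V) :
  (exists x, is_opair x s t /\ tagged n c x) ->
  (exists x, is_opair x s' t' /\ tagged n c x) -> s = s' /\ t = t'.
Proof.
  intros (x & Hx & H) (x' & Hx' & H'); apply is_opair_eq in Hx, Hx'; subst.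
  apply opair_inj; exact (tagged_unique _ _ _ _ H H').
Qed.

Lemma pair_code_exists n (s t : V) : exists c x, is_opair x s t /\ tagged n c x.
Proof.
  destruct (tagged_exists n (opair s t)) as (c & Hc); exists c, (opair s t).
  split; [apply is_opair_eq; reflexivity | exact Hc].
Qed.

(** [is_check] merely provides some partial function computing [c]. Two such functions agree by
    induction, so check names obey their recursion equation independently of the witness. *)
Lemma check_elem x c : is_check one x c ->
  (forall w, w ∈ x -> exists v, is_check one w v) /\
  (forall z, z ∈ c <-> exists w v, w ∈ x /\ is_check one w v /\ z = opair v one).
Proof.
  revert x c.
  assert (Hu : forall x c c', is_check one x c -> is_check one x c' -> c = c').
  { apply (mem_ind (fun x => forall c c', is_check one x c -> is_check one x c' -> c = c'));
      [def |].
    assert (Hhalf : forall x c c', (forall w, w ∈ x -> forall v v',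
              is_check one w v -> is_check one w v' -> v = v') ->
              is_check one x c -> is_check one x c' -> forall z, z ∈ c -> z ∈ c').
    { intros x c c' IH (f & Hxc & Hf & Hs) (f' & Hxc' & Hf' & Hs') z Hz.
      destruct (Hs x c Hxc) as [_ Hc], (Hs' x c' Hxc') as [Hd' Hc'].
      apply Hc in Hz; destruct Hz as (w & v & Hw & Hwv & E).
      destruct (Hd' w Hw) as (v' & Hwv'); apply Hc'; exists w, v'.
      replace v' with v in *; [auto |].
      apply (IH w Hw); [exists f | exists f']; auto. }
    intros x IH c c' H H'; apply set_ext; intro z.
    split; apply (Hhalf x); trivial. }
  intros x c (f & Hxc & Hf & Hs); destruct (Hs x c Hxc) as [Hd Hc].
  assert (Hw : forall w v, setrel f w v -> is_check one w v) by (intros w v H; exists f; auto).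
  split.
  - intros w Hwx; destruct (Hd w Hwx) as (v & Hv); eauto.
  - intro z; rewrite Hc; split.
    + intros (w & v & Hwx & Hwv & E); apply is_opair_eq in E; exists w, v; auto.
    + intros (w & v & Hwx & Hwv & E); destruct (Hd w Hwx) as (v' & Hv').
      rewrite (Hu w v v' Hwv (Hw w v' Hv')) in E; exists w, v'; rewrite is_opair_eq; auto.
Qed.

Lemma check_unique x c c' : is_check one x c -> is_check one x c' -> c = c'.
Proof.
  intros H H'; apply set_ext; intro z.
  rewrite (proj2 (check_elem x c H)), (proj2 (check_elem x c' H')); reflexivity.
Qed.

(** The evaluation is defined on all sets, not just on names; the conjunct [P r] ensures that the
    class of conditions below [r] is represented by a truth value. *)
Definition in_clause (E : V -> V -> V -> Prop) (s t p : V) : Prop :=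
  dense p (fun q => exists u r, opair u r ∈ t /\ P r /\ q ≤ r /\ E s u q).

Definition sub_clause (E : V -> V -> V -> Prop) (s t p : V) : Prop :=
  forall u r, opair u r ∈ s -> P r ->
    forall q', P q' -> q' ≤ p -> q' ≤ r -> exists q, P q /\ q ≤ q' /\ in_clause E u t q.

(** Equality is consulted only at first components of elements of [s] and [t], hence at pairs of
    smaller rank, where an approximation agrees with the final function. *)
Lemma sub_clause_ext (E E' : V -> V -> V -> Prop) s t p :
  P p ->
  (forall u r v r' q, opair u r ∈ s -> opair v r' ∈ t -> (E u v q <-> E' u v q)) ->
  sub_clause E s t p <-> sub_clause E' s t p.
Proof.
  assert (H : forall E E' : V -> V -> V -> Prop,
    (forall u r v r' q, opair u r ∈ s -> opair v r' ∈ t -> (E u v q <-> E' u v q)) ->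
    sub_clause E s t p -> sub_clause E' s t p).
  { intros F F' HFF H u r Hu Hr q' Hq' Hle Hle'.
    destruct (H u r Hu Hr q' Hq' Hle Hle') as (q & Hq & Hqq & Hin); exists q.
    do 2 (split; [assumption |]); revert Hin; apply dense_mono; [exact Hq |].
    intros x _ _ (v & r' & Hv & Hr' & Hx & HF); exists v, r'.
    do 3 (split; [assumption |]); apply (HFF u r v r'); trivial. }
  intros Hp HE; split; apply H; trivial.
  intros; symmetry; eapply HE; eassumption.
Qed.

(** * Recursion for equality *)

Section Evaluation.
Variables (B : V -> Prop) (T : V -> V -> Prop).
Hypothesis HT : truth_values B T.
Hypothesis HE : extensional B T.

Let DB : definable (fun e => B (e 0)) := tv_def_dom _ _ HT.
Let DT : definable (fun e => T (e 0) (e 1)) := tv_def _ _ HT.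
Local Notation rep := (rep B T).
Local Notation represents := (represents B T).

Lemma rep_in_clause (E : V -> V -> V -> Prop) s t :
  definable (fun e => E (e 0) (e 1) (e 2)) ->
  (forall u r, opair u r ∈ t -> rep (E s u)) -> rep (in_clause E s t).
Proof.
  intros HDE H.
  set (R := fun w q => exists u r, w = opair u r /\ P r /\ q ≤ r /\ E s u q).
  apply (rep_ext B T (fun p => dense p (fun q => exists w, w ∈ t /\ R w q))).
  - intros p Hp; split; apply dense_mono; trivial; intros q Hq _.
    + intros (w & Hw & u & r & -> & HR); eauto.
    + intros (u & r & Hu & HR); exists (opair u r); split; [exact Hu |].
      exists u, r; auto.
  - apply (rep_ex _ _ HT HE); [unfold R; def |].
    intros w Hw; destruct (classic (exists u r, w = opair u r /\ P r)) as [(u & r & -> & Hr) | Hn].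
    + apply (rep_ext B T (fun q => q ≤ r /\ E s u q)).
      * intros q Hq; split; [intros []; exists u, r; auto |].
        intros (u' & r' & Ew & _ & HH); apply opair_inj in Ew; destruct Ew; subst; exact HH.
      * apply (rep_and _ _ HT); [apply (rep_below _ _ HT), Hr | exact (H u r Hw)].
    + apply (rep_ext B T (fun _ => False)); [| apply (rep_false _ _ HT)].
      intros q Hq; split; [tauto |]; intros (u & r & Ew & Hr & _); apply Hn; eauto.
Qed.

Lemma rep_sub_clause (E : V -> V -> V -> Prop) s t :
  definable (fun e => E (e 0) (e 1) (e 2)) ->
  (forall u r v r', opair u r ∈ s -> opair v r' ∈ t -> rep (E u v)) ->
  rep (sub_clause E s t).
Proof.
  intros HDE H.
  set (R := fun w p => forall u r, w = opair u r -> P r ->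
    forall q', P q' -> q' ≤ p -> q' ≤ r -> exists q, P q /\ q ≤ q' /\ in_clause E u t q).
  apply (rep_ext B T (fun p => forall w, w ∈ s -> R w p)).
  - intros p Hp; split; intro HH.
    + intros u r Hu; exact (HH (opair u r) Hu u r eq_refl).
    + intros w Hw u r ->; exact (HH u r Hw).
  - apply (rep_all _ _ HT HE); [unfold R, in_clause, densely_below; def |].
    intros w Hw; destruct (classic (exists u r, w = opair u r /\ P r)) as [(u & r & -> & Hr) | Hn].
    + apply (rep_ext B T (fun p => forall q', P q' -> q' ≤ p -> q' ≤ r ->
               exists q, P q /\ q ≤ q' /\ in_clause E u t q)).
      * intros p Hp; split.
        -- intros HH u' r' Ew _; apply opair_inj in Ew; destruct Ew; subst; exact HH.
        -- intros HH; exact (HH u r eq_refl Hr).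
      * apply (rep_dense_imp _ _ HT); [exact Hr |].
        apply rep_in_clause; [exact HDE |]; intros v r' Hv; exact (H u r v r' Hw Hv).
    + apply (rep_ext B T (fun _ => True)); [| apply (rep_true _ _ HT)].
      intros p Hp; split; [| trivial]; intros _ u r Ew Hr; exfalso; apply Hn; eauto.
Qed.

(** Decoding a code quantifies over the whole universe, but at most one instance is relevant; if
    there is none, the condition is vacuously true. *)
Lemma rep_forall_unique (I : Type) (A : I -> Prop) (Q : I -> V -> Prop) :
  (forall i j, A i -> A j -> i = j) -> (forall i, A i -> rep (Q i)) ->
  rep (fun p => forall i, A i -> Q i p).
Proof.
  intros HA HQ; destruct (classic (exists i, A i)) as [(i & Hi) | Hn].
  - apply (rep_ext B T (Q i)); [| exact (HQ i Hi)].
    intros p Hp; split; [| auto]; intros H j Hj; rewrite (HA j i Hj Hi); exact H.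
  - apply (rep_ext B T (fun _ => True)); [| apply (rep_true _ _ HT)].
    intros p Hp; split; [| trivial]; intros _ i Hi; exfalso; apply Hn; eauto.
Qed.

Lemma equality_evaluation : exists E : V -> V -> V -> Prop,
  definable (fun e => E (e 0) (e 1) (e 2)) /\ (forall s t, rep (E s t)) /\
  forall s t p, P p -> (E s t p <-> sub_clause E s t p /\ sub_clause E t s p).
Proof.
  (* Reads off the truth value that the approximation [f] assigns to the pair. *)
  set (ev := fun f u v q => exists b, opair (opair u v) b ∈ f /\ T b q).
  set (clause := fun z f p => forall s t, z = opair s t ->
         sub_clause (ev f) s t p /\ sub_clause (ev f) t s p).
  (* The recursion returns the truth value of the clause, a set, in place of the class of conditions
     satisfying it. *)
  set (G := fun z f => iota (represents (clause z f))).
  destruct (rank_recursion G) as (F & DF & HF).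
  { unfold G, represents, clause, sub_clause, in_clause, densely_below, ev; def. }
  assert (HFG : forall z, (forall y, rlt y z -> B (F y)) ->
            represents (fun p => forall s t, z = opair s t ->
              sub_clause (fun u v => T (F (opair u v))) s t p /\
              sub_clause (fun u v => T (F (opair u v))) t s p) (F z)).
  { intros z IH; destruct (HF z) as (f & -> & Hf).
    assert (Hev : forall s t, z = opair s t -> forall u r v r' q,
              (opair u r ∈ s \/ opair u r ∈ t) -> (opair v r' ∈ s \/ opair v r' ∈ t) ->
              (ev f u v q <-> T (F (opair u v)) q) /\ B (F (opair u v))).
    { intros s t -> u r v r' q Hu Hv.
      assert (Hr : rlt (opair u v) (opair s t)).
      { apply rlt_opair; [destruct Hu | destruct Hv]; eauto using rlt_fst. }
      split; [| exact (IH _ Hr)]; split.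
      - intros (b & Hb & Hq); apply Hf in Hb; destruct Hb; subst; exact Hq.
      - intro Hq; exists (F (opair u v)); split; [apply Hf; auto | exact Hq]. }
    assert (Hcl : forall p, P p -> (clause z f p <-> forall s t, z = opair s t ->
              sub_clause (fun u v => T (F (opair u v))) s t p /\
              sub_clause (fun u v => T (F (opair u v))) t s p)).
    { assert (Hst : forall s t p, P p -> z = opair s t ->
        (sub_clause (ev f) s t p <-> sub_clause (fun u v => T (F (opair u v))) s t p) /\
        (sub_clause (ev f) t s p <-> sub_clause (fun u v => T (F (opair u v))) t s p)).
      { intros s t p Hp Hz; split; apply sub_clause_ext; trivial;
          intros u r v r' q Hu Hv; apply (Hev s t Hz u r v r'); auto. }
      intros p Hp; split; intros H s t Hz; specialize (H s t Hz);
        specialize (Hst s t p Hp Hz); tauto. }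
    assert (Hrep : rep (clause z f)).
    { apply (rep_ext B T (fun p => forall i, z = opair (fst i) (snd i) ->
        sub_clause (fun u v => T (F (opair u v))) (fst i) (snd i) p /\
        sub_clause (fun u v => T (F (opair u v))) (snd i) (fst i) p)).
      - intros p Hp; rewrite (Hcl p Hp); split.
        + intros H s t Hz; exact (H (s, t) Hz).
        + intros H [s t] Hz; exact (H s t Hz).
      - apply rep_forall_unique.
        + intros [s t] [s' t'] E E'; simpl in *; rewrite E in E'; apply opair_inj in E'.
          destruct E'; subst; reflexivity.
        + intros [s t] Hz; simpl in *; apply (rep_and _ _ HT); apply rep_sub_clause;
            try def; intros u r v r' Hu Hv; apply rep_value;
            eapply (Hev s t Hz u r v r' empty); auto. }
    assert (HG : represents (clause z f) (G z f)).
    { apply (iota_spec (represents (clause z f))); [exact Hrep |].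
      intros b b'; apply (represents_unique _ _ HE). }
    destruct HG as [HGB HGT]; split; [exact HGB |].
    intros p Hp; rewrite (HGT p Hp); apply Hcl, Hp. }
  assert (HFB : forall z, B (F z)).
  { apply (rlt_ind (fun z => B (F z))); [def |]; intros z IH; apply (HFG z IH). }
  exists (fun s t => T (F (opair s t))); split; [def | split].
  - intros s t; apply rep_value, HFB.
  - intros s t p Hp; destruct (HFG (opair s t)) as [_ H]; [auto |].
    rewrite (H p Hp); split.
    + intro HH; exact (HH s t eq_refl).
    + intros HH s' t' Ez; apply opair_inj in Ez; destruct Ez; subst; exact HH.
Qed.

(** * The generic filter and infinitary sentences *)

Section Sentences.
Variable E : V -> V -> V -> Prop.
Hypothesis DE : definable (fun e => E (e 0) (e 1) (e 2)).
Hypothesis E_rep : forall s t, rep (E s t).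
Hypothesis E_spec : forall s t p,
  P p -> (E s t p <-> sub_clause E s t p /\ sub_clause E t s p).

(* If [q] forces [s] to equal the check name of [r], then every element of [r]
   has a check name that some condition forces equal to a name in the domain of
   [s]; this bounds [r] by recursion on [s]. *)
Lemma isset_checks s :
  isset (fun r => exists t q, is_check one r t /\ P q /\ E s t q).
Proof.
  set (supp := fun s r => exists t q, is_check one r t /\ P q /\ E s t q).
  set (g := fun s => setof (supp s)).
  assert (Dsupp : definable (fun e => supp (e 0) (e 1))) by (unfold supp; def).
  assert (Dg : definable (fun e => e 0 = g (e 1))) by (unfold g; def).
  change (isset (supp s)); revert s.
  apply (rlt_ind (fun s => isset (supp s))); [unfold isset; def |].
  (* The double union contains the domain of [s], as [u] is an element of [{u}], which is an element
     of the pair of [u] and [r']. *)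
  intros s IH; destruct (isset_fun_image g (union (union s)) Dg) as (a & Ha).
  apply (isset_sep _ (power (union a))); [def |].
  intros r (t & q & Hrt & Hq & HEq); apply in_power; intros w Hw.
  destruct (check_elem r t Hrt) as [Hd Hel]; destruct (Hd w Hw) as (v & Hv).
  apply E_spec in HEq; [| exact Hq]; destruct HEq as [_ Hsub].
  (* The check name [v] of [w] occurs in [t] with condition [one], so some extension of [q] forces
     it equal to a name in the domain of [s]. *)
  destruct (Hsub v one) with (q' := q) as (q1 & Hq1 & _ & Hin); trivial.
  - apply Hel; eauto.
  - exact one_in.
  - apply le_refl, Hq.
  - apply le_one, Hq.
  - destruct (Hin q1 Hq1 (le_refl q1 Hq1)) as (q2 & Hq2 & _ & u & r' & Hu & _ & _ & HEu).
    apply in_union; exists (g u); split.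
    + apply Ha; exists u; split; [| reflexivity].
      apply in_union; exists (upair u u); split; [| apply in_upair; auto].
      apply in_union; exists (opair u r'); split; [exact Hu | apply in_upair; auto].
    + apply (in_setof _ (IH u (rlt_fst _ _ _ Hu))); exists v, q2.
      do 2 (split; [assumption |]); apply E_spec; [exact Hq2 |].
      apply E_spec in HEu; tauto.
Qed.

Definition generic_clause (s p : V) : Prop :=
  dense p (fun q => exists t r, in_Gdot P one t r /\ q ≤ r /\ E s t q).

(** The disjunction ranges over the conditions [r], possibly a proper class; those outside the set
    given by [isset_checks] contribute nothing, which leaves a set-sized one. *)
Lemma rep_generic_clause s : rep (generic_clause s).
Proof.
  destruct (isset_checks s) as (a & Ha).
  set (R := fun r q => P r /\ q ≤ r /\ exists t, is_check one r t /\ E s t q).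
  apply (rep_ext B T (fun p => dense p (fun q => exists r, r ∈ a /\ R r q))).
  - intros p Hp; split; apply dense_mono; trivial; intros q Hq _.
    + intros (r & _ & Hr & Hqr & t & Ht & HEt); exists t, r; unfold in_Gdot; auto.
    + intros (t & r & [Hr Ht] & Hqr & HEt); exists r; split; [apply Ha; eauto |].
      split; eauto.
  - apply (rep_ex _ _ HT HE); [unfold R; def |]; intros r _.
    destruct (classic (P r /\ exists t, is_check one r t)) as [(Hr & t & Ht) | Hn].
    + apply (rep_ext B T (fun q => q ≤ r /\ E s t q)).
      * intros q Hq; split; [intros []; split; eauto |].
        intros (_ & Hqr & t' & Ht' & HEt); rewrite (check_unique r t t' Ht Ht'); auto.
      * apply (rep_and _ _ HT); [apply (rep_below _ _ HT), Hr | apply E_rep].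
    + apply (rep_ext B T (fun _ => False)); [| apply (rep_false _ _ HT)].
      intros q Hq; split; [tauto |]; intros (Hr & _ & t & Ht & _); apply Hn; eauto.
Qed.

(** Discharges the clauses for constructors other than that of [c], which are vacuous because a code
    has one tag. *)
Ltac other_tag Htag Hx :=
  let y := fresh in let Hy := fresh in
  first [ intros ? ? (y & _ & Hy) | intros y Hy ]; exfalso;
  eapply Htag; [exact Hx | exact Hy | discriminate].

(** The five cases are merged into one conjunction of implications, one for each constructor. The
    evaluation is thereby total: a set that codes nothing is evaluated as true. *)
Lemma sentence_evaluation : exists S : V -> V -> Prop,
  definable (fun e => S (e 0) (e 1)) /\
  forall c p, P p ->
    (forall s t, eq_code c s t -> (S c p <-> E s t p)) /\
    (forall s t, in_code c s t -> (S c p <-> in_clause E s t p)) /\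
    (forall s, gen_code c s -> (S c p <-> generic_clause s p)) /\
    (forall d, neg_code c d -> (S c p <-> forall q, P q -> q ≤ p -> ~ S d q)) /\
    (forall J, conj_code c J -> (S c p <-> forall d, d ∈ J -> S d p)).
Proof.
  set (clause := fun (Q : V -> V -> Prop) c p =>
    (forall s t, eq_code c s t -> E s t p) /\
    (forall s t, in_code c s t -> in_clause E s t p) /\
    (forall s, tagged 2 c s -> generic_clause s p) /\
    (forall d, tagged 3 c d -> forall q, P q -> q ≤ p -> ~ Q d q) /\
    (forall J, tagged 4 c J -> forall d, d ∈ J -> Q d p)).
  set (ev := fun f d q => exists b, opair d b ∈ f /\ T b q).
  set (G := fun c f => iota (represents (clause (ev f) c))).
  destruct (rank_recursion G) as (F & DF & HF).
  { unfold G, represents, clause, generic_clause, in_Gdot, in_clause, densely_below, ev;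
      def. }
  assert (Hrep : forall (Q : V -> V -> Prop) c, definable (fun e => Q (e 0) (e 1)) ->
            (forall d, rlt d c -> rep (Q d)) -> rep (clause Q c)).
  { intros Q c HQ H; unfold clause; repeat apply (rep_and _ _ HT).
    - apply (rep_ext B T (fun p => forall i, eq_code c (fst i) (snd i) ->
               E (fst i) (snd i) p)).
      + intros p Hp; split; [intros HH s t Hc; exact (HH (s, t) Hc) | auto].
      + apply rep_forall_unique; [| auto].
        intros [s t] [s' t'] Hc Hc'; destruct (pair_code_unique _ _ _ _ _ _ Hc Hc').
        simpl in *; congruence.
    - apply (rep_ext B T (fun p => forall i, in_code c (fst i) (snd i) ->
               in_clause E (fst i) (snd i) p)).
      + intros p Hp; split; [intros HH s t Hc; exact (HH (s, t) Hc) | auto].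
      + apply rep_forall_unique.
        * intros [s t] [s' t'] Hc Hc'; destruct (pair_code_unique _ _ _ _ _ _ Hc Hc').
          simpl in *; congruence.
        * intros [s t] _; apply rep_in_clause; auto.
    - apply rep_forall_unique; [intros s s'; apply tagged_unique |].
      intros s _; apply rep_generic_clause.
    - apply rep_forall_unique; [intros s s'; apply tagged_unique |].
      intros d Hd; apply (rep_not _ _ HT), H, (rlt_tagged _ _ _ Hd).
    - apply rep_forall_unique; [intros s s'; apply tagged_unique |].
      intros J HJ; apply (rep_all _ _ HT HE); [exact HQ |].
      intros d Hd; apply H, (rlt_trans _ J); [apply rlt_mem, Hd | exact (rlt_tagged _ _ _ HJ)]. }
  (* The clause for [c] depends on its recursive argument only below the rank of [c], so an
     approximation and the final [S] are interchangeable in it. *)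
  assert (Hclause : forall Q Q' : V -> V -> Prop, forall c p,
            (forall d q, rlt d c -> (Q d q <-> Q' d q)) -> clause Q c p -> clause Q' c p).
  { intros Q Q' c p H (H1 & H2 & H3 & H4 & H5); do 3 (split; [assumption |]); split.
    - intros d Hd q Hq Hqp HQ; apply (H4 d Hd q Hq Hqp), H; [| exact HQ].
      exact (rlt_tagged _ _ _ Hd).
    - intros J HJ d Hd; apply H; [| exact (H5 J HJ d Hd)].
      apply (rlt_trans _ J); [apply rlt_mem, Hd | exact (rlt_tagged _ _ _ HJ)]. }
  set (S := fun c => T (F c)).
  assert (DS : definable (fun e => S (e 0) (e 1))) by (unfold S; def).
  assert (HFS : forall c, (forall d, rlt d c -> B (F d)) -> represents (clause S c) (F c)).
  { intros c IH; destruct (HF c) as (f & -> & Hf).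
    assert (Hev : forall d q, rlt d c -> (ev f d q <-> S d q)).
    { intros d q Hd; split.
      - intros (b & Hb & Hq); apply Hf in Hb; destruct Hb; subst; exact Hq.
      - intro Hq; exists (F d); split; [apply Hf; auto | exact Hq]. }
    assert (Hcl : forall p, P p -> (clause S c p <-> clause (ev f) c p)).
    { intros p _; split; apply Hclause; intros d q Hd; [symmetry |]; apply Hev, Hd. }
    assert (HG : represents (clause (ev f) c) (G c f)).
    { apply (iota_spec (represents (clause (ev f) c))).
      - apply (rep_ext B T (clause S c)); [exact Hcl |].
        apply Hrep; [exact DS |]; intros d Hd; exact (rep_value B T (F d) (IH d Hd)).
      - intros b b'; apply (represents_unique _ _ HE). }
    destruct HG as [HGB HGT]; split; [exact HGB |].
    intros p Hp; rewrite (HGT p Hp), (Hcl p Hp); reflexivity. }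
  assert (HFB : forall c, B (F c)).
  { apply (rlt_ind (fun c => B (F c))); [def |]; intros c IH; apply (HFS c IH). }
  exists S; split; [exact DS |].
  intros c p Hp; destruct (HFS c) as [_ HS]; [auto |]; specialize (HS p Hp).
  change (T (F c) p) with (S c p) in HS.
  assert (Htag : forall m n x y, tagged m c x -> tagged n c y -> m <> n -> False).
  { intros m n x y Hx Hy Hmn; apply Hmn; exact (tagged_tag _ _ _ _ _ Hx Hy). }
  split; [| split; [| split; [| split]]].
  - intros s t Hc; rewrite HS; split; [intros [H _]; exact (H s t Hc) |].
    intro H; pose proof Hc as (x & _ & Hx); repeat split; try other_tag Htag Hx.
    intros s' t' Hc'; destruct (pair_code_unique _ _ _ _ _ _ Hc Hc'); subst; exact H.
  - intros s t Hc; rewrite HS; split; [intros (_ & H & _); exact (H s t Hc) |].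
    intro H; pose proof Hc as (x & _ & Hx); repeat split; try other_tag Htag Hx.
    intros s' t' Hc'; destruct (pair_code_unique _ _ _ _ _ _ Hc Hc'); subst; exact H.
  - intros s Hx; rewrite HS; split; [intros (_ & _ & H & _); exact (H s Hx) |].
    intro H; repeat split; try other_tag Htag Hx.
    intros y Hy; rewrite (tagged_unique _ _ _ _ Hy Hx); exact H.
  - intros d Hx; rewrite HS; split; [intros (_ & _ & _ & H & _); exact (H d Hx) |].
    intro H; repeat split; try other_tag Htag Hx.
    intros y Hy; rewrite (tagged_unique _ _ _ _ Hy Hx); exact H.
  - intros J Hx; rewrite HS; split; [intros (_ & _ & _ & _ & H); exact (H J Hx) |].
    intro H; repeat split; try other_tag Htag Hx.
    intros y Hy; rewrite (tagged_unique _ _ _ _ Hy Hx); exact H.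
Qed.

End Sentences.

(** * The uniform forcing relation *)

Lemma truth_values_uniform : admits_uniform_forcing_relation P le one.
Proof.
  destruct equality_evaluation as (E & DE & E_rep & E_spec).
  destruct (sentence_evaluation E DE E_rep E_spec) as (S & DS & HS).
  destruct (class_of (fun z => exists p c, z = opair p c /\ S c p)) as (F & HF0); [def |].
  assert (HF : forall p c, rel F p c <-> S c p).
  { intros p c; rewrite rel_eq, HF0; split.
    - intros (p' & c' & Ez & H); apply opair_inj in Ez; destruct Ez; subst; exact H.
    - eauto. }
  destruct (class_of (fun z => exists p s t, z = opair p (opair s t) /\
              sub_clause E s t p)) as (Fsub & HFsub0);
    [unfold sub_clause, in_clause, densely_below; def |].
  assert (HFsub : forall p s t, rel3 Fsub p s t <-> sub_clause E s t p).
  { intros p s t; rewrite rel3_eq, HFsub0; split.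
    - intros (p' & s' & t' & Ez & H); apply opair_inj in Ez; destruct Ez as [-> Ez].
      apply opair_inj in Ez; destruct Ez; subst; exact H.
    - intro H; exists p, s, t; auto. }
  assert (Heq : forall p s t, P p -> ((exists c, eq_code c s t /\ rel F p c) <-> E s t p)).
  { intros p s t Hp; split.
    - intros (c & Hc & H); apply (HS c p Hp); [exact Hc | apply HF, H].
    - intro H; destruct (pair_code_exists 0 s t) as (c & Hc); exists c.
      split; [exact Hc |]; apply HF; apply (proj1 (HS c p Hp) s t Hc), H. }
  assert (Hin : forall p s t, P p ->
            ((exists c, in_code c s t /\ rel F p c) <-> in_clause E s t p)).
  { intros p s t Hp; split.
    - intros (c & Hc & H); apply (HS c p Hp); [exact Hc | apply HF, H].
    - intro H; destruct (pair_code_exists 1 s t) as (c & Hc); exists c.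
      split; [exact Hc |]; apply HF; apply (proj1 (proj2 (HS c p Hp)) s t Hc), H. }
  exists F, Fsub; split.
  - split.
    + intros p s t Hp Hs Ht; rewrite (Hin p s t Hp).
      split; apply dense_mono; trivial; intros q Hq _.
      * intros (u & r & Hu & Hr & Hqr & H); exists u, r; rewrite setrel_eq, Heq; auto.
      (* Since [t] is a name, [r] is a condition, as [in_clause] demands. *)
      * intros (u & r & Hu & Hqr & H); apply setrel_eq in Hu.
        apply Heq in H; [| exact Hq]; exists u, r.
        destruct (name_pair _ _ _ Ht Hu); auto.
    + intros p s t Hp _ _; rewrite !HFsub, (Heq p s t Hp); apply E_spec, Hp.
    + intros p s t Hp Hs Ht; rewrite HFsub; split.
      * intros H u r q' Hu Hq' Hle Hle'; apply setrel_eq in Hu.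
        destruct (name_pair _ _ _ Hs Hu) as [_ Hr].
        destruct (H u r Hu Hr q' Hq' Hle Hle') as (q & Hq & Hqq & HH).
        exists q; rewrite (Hin q u t Hq); auto.
      * intros H u r Hu Hr q' Hq' Hle Hle'.
        destruct (H u r q') as (q & Hq & Hqq & HH); trivial; [apply setrel_eq, Hu |].
        exists q; rewrite (Hin q u t Hq) in HH; auto.
  - intros p s c Hp _ Hc; rewrite HF, (proj1 (proj2 (proj2 (HS c p Hp))) s Hc).
    split; apply dense_mono; trivial; intros q Hq _ (t & r & Hg & Hqr & H);
      exists t, r; do 2 (split; [assumption |]); revert H; apply Heq, Hq.
  - intros p c J Hp _ Hc; rewrite HF.
    rewrite (proj2 (proj2 (proj2 (proj2 (HS c p Hp)))) J Hc).
    split; intros H d Hd; apply HF, H, Hd.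
  - intros p c d Hp _ Hc; rewrite HF.
    rewrite (proj1 (proj2 (proj2 (proj2 (HS c p Hp)))) d Hc).
    split; intros H q Hq Hqp HH; apply (H q Hq Hqp), HF, HH.
Qed.

End Evaluation.

End ForcingNotion.
End GBCModel.

Theorem theorem14 (M : gb_structure) (HM : GBC M)
    (P le : Class M) (one : V M) (HP : class_forcing P le one) :
  (admits_atomic_forcing_relation P le <->
   admits_uniform_forcing_relation P le one) /\
  (admits_uniform_forcing_relation P le one <->
   admits_boolean_completion P le).
Proof.
  assert (Hua : admits_uniform_forcing_relation P le one ->
                admits_atomic_forcing_relation P le) by apply uniform_atomic, HM.
  assert (Hat : admits_atomic_forcing_relation P le -> exists B T,
            truth_values P le B T /\ extensional P B T).
  { intros (Fin & Fsub & Feq & HF).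
    destruct (atomic_truth_values HM P le one HP Fin Fsub Feq HF) as (B & T & HT).
    exact (extensional_truth_values HM P le one HP B T HT). }
  assert (Htu : (exists B T, truth_values P le B T /\ extensional P B T) ->
            admits_uniform_forcing_relation P le one).
  { intros (B & T & HT & HE); exact (truth_values_uniform HM P le one HP B T HT HE). }
  split; split; auto.
  - intro H; destruct (Hat (Hua H)) as (B & T & HT & HE).
    exact (truth_values_completion HM P le one HP B T HT HE).
  - intro H; apply Htu; exact (completion_truth_values HM P le one HP H).
Qed.
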